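(* There exist a computably approximable Martin-Löf random real $\beta$ and functions $h,\tilde f,\tilde h:\mathbb{R}\to\mathbb{R}$ such that $(-h,h)$ is a translation function interval from $\beta$ to $0$, $(\tilde f,\tilde h)$ is a translation function interval from $\beta$ to $\beta$, and all of the following hold: \begin{itemize} \item $h$ is Lipschitz continuous, and $\tilde f$ and $\tilde h$ are nondecreasing; \item $\displaystyle\liminf_{x\nearrow\beta}|D^{h}_{\beta}(x)| = \liminf_{x\searrow\beta}|D^{h}_{\beta}(x)| = 0 < 1 = \limsup_{x\nearrow\beta}|D^{h}_{\beta}(x)| = \limsup_{x\searrow\beta}|D^{h}_{\beta}(x)|$; \item $\displaystyle\limsup_{x\nearrow\beta}|D^{\tilde f}_{\beta}(x)| = \infty = \limsup_{x\searrow\beta}|D^{\tilde h}_{\beta}(x)|$. \end{itemize}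
   Context: Notation: for a function $g:\mathbb{R}\to\mathbb{R}$ and reals $x\neq y$, $D^g_y(x)=\frac{g(y)-g(x)}{y-x}$. The symbols $x\nearrow\beta$ and $x\searrow\beta$ mean that $x$ tends to $\beta$ from the left ($x<\beta$) and from the right ($x>\beta$), respectively. A computable approximation is a computable Cauchy (i.e. convergent in $\mathbb{R}$) sequence of rationals $a_0,a_1,\dots$; a real is computably approximable (c.a.) if it is the limit of a computable approximation. A Cauchy name of a real $x$ is a sequence of rationals $q_0,q_1,\dots$ converging to $x$ such that $|q_m-q_n|\le 2^{-n}$ for all $m\ge n$. A function $f:\mathbb{R}\to\mathbb{R}$ is lower semicomputable (on $\mathbb{R}$) if there is an oracle Turing functional that, for every real $x$ and every Cauchy name of $x$ given as oracle, outputs an increasing sequence of rationals converging to $f(x)$; $f$ is upper semicomputable if $-f$ is lower semicomputable. A translation function interval (function interval for short) $(f,h)$ from a real $\beta$ to a real $\alpha$ is a pair of functions $f,h:\mathbb{R}\to\mathbb{R}$ such that (i) $f(x)\le h(x)$ for all $x\in\mathbb{R}$; (ii) $f$ is lower semicomputable; (iii) $h$ is upper semicomputable; (iv) $f(\beta)=h(\beta)=\alpha$. A Martin-Löf test is a uniformly computably enumerable sequence of open sets $(L_n)_{n\in\mathbb{N}}$ of reals with Lebesgue measure $\mu(L_n)\le 2^{-n}$ for all $n$; a real $\beta$ is Martin-Löf random if there is no Martin-Löf test $(L_n)_{n\in\mathbb{N}}$ with $\beta\in\bigcap_n L_n$. A function $g$ is Lipschitz continuous if there is a constant $L$ with $|g(x)-g(y)|\le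 L|x-y|$ for all $x,y$ in its domain. *)

(* Defs.v *)
(* Stdlib is used only for the Cantor pairing. *)
From Stdlib Require Cantor.
From mathcomp Require Export all_boot all_order all_algebra.
From mathcomp Require Export all_classical all_reals all_analysis.

Set Implicit Arguments.
Unset Strict Implicit.
Unset Printing Implicit Defensive.

Import Order.TTheory GRing.Theory Num.Theory.
Import numFieldNormedType.Exports.

Local Open Scope classical_set_scope.
Local Open Scope ring_scope.

(** * Turing functionals

    Oracle computation is modelled by Kleene's partial recursive functionals:
    the partial functions obtained from the basic functions and an oracle
    [g : nat -> nat] by pairing, composition, primitive recursion and
    minimization.  All functions are unary; several arguments are packed with
    the (bijective) Cantor pairing. *)

Definition pr (m n : nat) : nat := Cantor.to_nat (m, n).
Definition pr1 (n : nat) : nat := (Cantor.of_nat n).1.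
Definition pr2 (n : nat) : nat := (Cantor.of_nat n).2.

Inductive code : Type :=
| CZero
| CSucc
| CFst
| CSnd
| COracle
| CPair of code & code
| CComp of code & code
| CPrec of code & code
| CMin of code.

(* [eval g c x y]: the functional [c] with oracle [g] halts on [x] with
   output [y].  The identity is [CPair CFst CSnd]. *)
Inductive eval (g : nat -> nat) : code -> nat -> nat -> Prop :=
| EZero x : eval g CZero x 0
| ESucc x : eval g CSucc x x.+1
| EFst x : eval g CFst x (pr1 x)
| ESnd x : eval g CSnd x (pr2 x)
| EOracle x : eval g COracle x (g x)
| EPair c d x y z :
    eval g c x y -> eval g d x z -> eval g (CPair c d) x (pr y z)
| EComp c d x y z :
    eval g d x y -> eval g c y z -> eval g (CComp c d) x z
| EPrec0 c d x y :
    eval g c x y -> eval g (CPrec c d) (pr x 0) y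
| EPrecS c d x n y z :
    eval g (CPrec c d) (pr x n) y -> eval g d (pr x (pr n y)) z ->
    eval g (CPrec c d) (pr x n.+1) z
| EMin c x n (k : nat -> nat) :
    (forall m, (m < n)%N -> eval g c (pr x m) (k m).+1) ->
    eval g c (pr x n) 0 ->
    eval g (CMin c) x n.

(* Computation without an oracle is computation with the zero oracle. *)
Definition eval0 : code -> nat -> nat -> Prop := eval (fun=> 0%N).

(* A surjective, non-injective numbering of the rationals:
   ((p, q), d) stands for (p - q) / (d + 1). *)
Definition rat_of_code (n : nat) : rat :=
  ((pr1 (pr1 n))%:R - (pr2 (pr1 n))%:R) / (pr2 n).+1%:R.

Section ComputableAnalysis.
Variable R : realType.

Definition computable_rat_seq (a : nat -> rat) : Prop :=
  exists c : code, forall n, exists2 k, eval0 c n k & rat_of_code k = a n.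

Definition computably_approximable (x : R) : Prop :=
  exists2 a : nat -> rat, computable_rat_seq a &
    (ratr (a n) : R) @[n --> \oo] --> x.

Definition cauchy_name (q : nat -> rat) (x : R) : Prop :=
  (ratr (q n) : R) @[n --> \oo] --> x /\
  forall m n, (n <= m)%N -> `|q m - q n| <= 2^-1 ^+ n.

(* A name [q] is presented to the machine by an oracle [g] listing codes of
   the rationals [q 0], [q 1] and so on. *)
Definition lower_semicomputable (f : R -> R) : Prop :=
  exists c : code, forall (x : R) (q : nat -> rat) (g : nat -> nat),
    cauchy_name q x -> (forall n, rat_of_code (g n) = q n) ->
    exists r : nat -> rat,
      [/\ forall n, exists2 k, eval g c n k & rat_of_code k = r n,
          increasing_seq r
        & (ratr (r n) : R) @[n --> \oo] --> f x].

Definition upper_semicomputable (f : R -> R) : Prop :=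
  lower_semicomputable (fun x => - f x).

Definition translation_function_interval (f h : R -> R) (beta alpha : R) :
    Prop :=
  [/\ forall x, f x <= h x,
      lower_semicomputable f,
      upper_semicomputable h,
      f beta = alpha
    & h beta = alpha].

(* The union of the rational open intervals ]a, b[ with (n, (a, b)) in the
   c.e. set W_c, the domain of the partial computable function [c]. *)
Definition ce_open (c : code) (n : nat) : set R :=
  [set x | exists i j : nat, (exists y, eval0 c (pr n (pr i j)) y) /\
    ratr (rat_of_code i) < x < ratr (rat_of_code j)].

Definition uniformly_ce_open (L : nat -> set R) : Prop :=
  exists c : code, forall n, L n = ce_open c n.

Definition martin_lof_test (L : nat -> set R) : Prop :=
  uniformly_ce_open L /\
  forall n, (lebesgue_measure (L n) <= (2^-1 ^+ n)%:E)%E.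

Definition martin_lof_random (x : R) : Prop :=
  ~ exists L : nat -> set R, martin_lof_test L /\ (\bigcap_n L n) x.

Definition diff_quotient (g : R -> R) (y x : R) : R := (g y - g x) / (y - x).

Definition liminf_left (g : R -> R) (b : R) : \bar R :=
  limf_einf (fun x => (g x)%:E) b^'-.
Definition liminf_right (g : R -> R) (b : R) : \bar R :=
  limf_einf (fun x => (g x)%:E) b^'+.
Definition limsup_left (g : R -> R) (b : R) : \bar R :=
  limf_esup (fun x => (g x)%:E) b^'-.
Definition limsup_right (g : R -> R) (b : R) : \bar R :=
  limf_esup (fun x => (g x)%:E) b^'+.

End ComputableAnalysis.

(* Main.v *)
Require Import Defs.
From mathcomp Require Import zify ring lra.

Import Order.TTheory GRing.Theory Num.Theory.
Import numFieldNormedType.Exports.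
Local Open Scope classical_set_scope.
Local Open Scope ring_scope.

(** The whole statement reduces to one number [beta] and one computable
    sequence of rationals, called [point] below, that accumulates at [beta] from
    the left and from the right and that nevertheless leaves, on each side,
    arbitrarily short open intervals free of points whose far end is arbitrarily
    many times farther from [beta] than their near end.  Given these, let [h x]
    be the distance from [x] to the points, [ft x] the supremum of the points
    below [x] and [ht x] the infimum of the points above [x].  Since the points
    can be enumerated, these envelopes are semicomputable on the required side;
    they meet at [beta] because the points accumulate there.  The difference
    quotient of [h] vanishes at each point, and it is nearly 1 in modulus at the
    middle of a long gap, whose ends are both about as far from the middle as
    [beta] is.  At the near end of a gap, [ft] (or [ht]) is still stuck
    behind the far end, which makes its difference quotient as large as the
    ratio of the gap.  This part is [envelope_interval].

    To find [beta], consider a tree of nested intervals, the cells.  All partial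
    computable functions are run step by step.  The e-th one is read as a
    Martin-Lof test at its level e+3; it strikes the cells that it covers, but
    it is ignored whenever it covers more than a fraction 2^-(e+2) of the
    cells of a level.  A genuine test is never ignored ([active_measure]),
    because the cells of a level fill at least half of the unit interval
    ([half_nodes]), and all tests together strike less than half of the cells
    ([least_spec]).  So every level has a first cell that is not struck, in the
    numbering of the nodes.  As more cells get struck this first node can only
    move forward, hence its ancestor at each fixed level stabilises
    ([limit_branch_exists]).  The stable ancestors form a branch, and [beta] is
    the point in the cells of that branch.  It is the limit of a computable
    sequence by construction, and it is random because its cells are never
    struck ([branch_point_random]).

    The gaps come from the numbering, which runs through the children of a node
    from left to right at even levels and from right to left at odd levels.  The
    points are the ends of all cells that are ever ancestors of a first
    unstruck node, together with the integers.  Consider an even level.  As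
    long as the guess at the parent is right, wrong guesses at the child lie to
    the left of the true child, and while both are right all deeper guesses lie
    in the true child; wrong guesses at the parent or above lie outside the
    parent.  So no point
    separates the right end of the true child from the right end of its parent
    ([no_point_right]), and symmetrically on the left at odd levels
    ([no_point_left]).  These gaps have a large ratio because the children are
    kept away from the ends of their parent, by a number of child widths
    ([margin]) that tends to infinity with the level. *)

(** * Computable functionals *)

Section Computes.
Local Open Scope nat_scope.

Lemma pr1_pr m n : pr1 (pr m n) = m.
Proof. by rewrite /pr1 /pr Cantor.cancel_of_to. Qed.

Lemma pr2_pr m n : pr2 (pr m n) = n.
Proof. by rewrite /pr2 /pr Cantor.cancel_of_to. Qed.

Lemma pr_eta n : pr (pr1 n) (pr2 n) = n.
Proof. by rewrite /pr /pr1 /pr2 -surjective_pairing Cantor.cancel_to_of. Qed.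

(** Totality is built in: one code must halt on every input, for every
    oracle.  Oracle-free functions are the [F] that ignore their first argument,
    so that a single closure calculus serves for plain and for relative
    computability.  Boolean functions are computed through their numeric value
    0 or 1. *)
Definition computes (F : (nat -> nat) -> nat -> nat) : Prop :=
  exists c, forall g x, eval g c x (F g x).

Lemma computes_ext F G :
  (forall g x, F g x = G g x) -> computes F -> computes G.
Proof. by move=> FG [c cP]; exists c => g x; rewrite -FG. Qed.

Lemma computes_const n : computes (fun _ _ => n).
Proof.
elim: n => [|n [c cP]]; first by exists CZero => g x; constructor.
by exists (CComp CSucc c) => g x; apply: EComp (cP g x) _; constructor.
Qed.

Lemma computes_id : computes (fun _ x => x).
Proof.
by exists (CPair CFst CSnd) => g x; rewrite -{2}(pr_eta x); do 2! constructor.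
Qed.

Lemma computes_comp F G :
  computes F -> computes G -> computes (fun g x => F g (G g x)).
Proof.
by move=> [c cP] [d dP]; exists (CComp c d) => g x; apply: EComp (dP g x) _.
Qed.

Lemma computes_pr F G :
  computes F -> computes G -> computes (fun g x => pr (F g x) (G g x)).
Proof. by move=> [c cP] [d dP]; exists (CPair c d) => g x; apply: EPair. Qed.

Lemma computes_pr1 F : computes F -> computes (fun g x => pr1 (F g x)).
Proof.
by apply: (@computes_comp (fun _ => pr1)); exists CFst => g x; constructor.
Qed.

Lemma computes_pr2 F : computes F -> computes (fun g x => pr2 (F g x)).
Proof.
by apply: (@computes_comp (fun _ => pr2)); exists CSnd => g x; constructor.
Qed.

Lemma computes_succ F : computes F -> computes (fun g x => (F g x).+1).
Proof.
by apply: (@computes_comp (fun _ => S)); exists CSucc => g x; constructor.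
Qed.

Lemma computes_oracle F : computes F -> computes (fun g x => g (F g x)).
Proof.
by apply: (@computes_comp (fun g => g)); exists COracle => g x; constructor.
Qed.

(** The recursion step [D] may use the ambient argument [x], which the code
    has to carry along in the first component of its input. *)
Lemma computes_rec C D N :
  computes C ->
  computes (fun g p => D g (pr1 p) (pr1 (pr2 p)) (pr2 (pr2 p))) ->
  computes N ->
  computes (fun g x => nat_rec (fun=> nat) (C g x) (D g x) (N g x)).
Proof.
move=> [c cP] [d dP] cN.
pose F g p := nat_rec (fun=> nat) (C g (pr1 p)) (D g (pr1 p)) (pr2 p).
suff cF : computes F.
  have := computes_comp _ _ cF (computes_pr _ _ computes_id cN).
  by apply: computes_ext => g x; rewrite /F pr1_pr pr2_pr.
exists (CPrec c d) => g p; rewrite -{1}(pr_eta p) /F.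
elim: (pr2 p) => [|n IHn] /=; first exact: EPrec0.
by apply: EPrecS IHn _; have := dP g (pr (pr1 p) (pr n (F g (pr (pr1 p) n))));
   rewrite /F !(pr1_pr, pr2_pr).
Qed.

End Computes.

(** A goal [computes (fun g x => t)] is solved by recursion on the head symbols
    of [t]; bound variables become projections of the packed input. *)
Create HintDb comp.
#[local] Hint Resolve computes_const computes_id computes_pr computes_pr1
  computes_pr2 computes_succ computes_oracle : comp.
#[local] Hint Extern 9 (computes _) =>
  match goal with H : computes _ |- _ => refine (computes_comp _ _ H _) end
  : comp.

Ltac comp := auto 200 with comp nocore.

Section Arithmetic.
Local Open Scope nat_scope.
Variables F G : (nat -> nat) -> nat -> nat.
Variables b d : (nat -> nat) -> nat -> bool.
Hypotheses (cF : computes F) (cG : computes G).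
Hypotheses (cb : computes (fun g x => b g x)).
Hypotheses (cd : computes (fun g x => d g x)).

Lemma computes_pred : computes (fun g x => (F g x).-1).
Proof.
apply: (@computes_ext (fun g x => nat_rec (fun=> nat) 0 (fun n _ => n) (F g x))).
  by move=> g x; case: (F g x).
by apply: computes_rec; comp.
Qed.

Lemma computes_add : computes (fun g x => F g x + G g x).
Proof.
apply: (@computes_ext
  (fun g x => nat_rec (fun=> nat) (F g x) (fun _ y => y.+1) (G g x))).
  by move=> g x; elim: (G g x) => [|n /= ->]; rewrite ?addn0 ?addnS.
by apply: computes_rec; comp.
Qed.

Lemma computes_if : computes (fun g x => if b g x then F g x else G g x).
Proof.
apply: (@computes_ext
  (fun g x => nat_rec (fun=> nat) (G g x) (fun _ _ => F g x) (b g x))).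
  by move=> g x; case: (b g x).
by apply: computes_rec; comp.
Qed.

Lemma computes_and : computes (fun g x => b g x && d g x).
Proof.
apply: (@computes_ext (fun g x => nat_rec (fun=> nat) 0 (fun _ _ => d g x) (b g x))).
  by move=> g x; case: (b g x).
by apply: computes_rec; comp.
Qed.

Lemma computes_not : computes (fun g x => ~~ b g x).
Proof.
apply: (@computes_ext (fun g x => nat_rec (fun=> nat) 1 (fun _ _ => 0) (b g x))).
  by move=> g x; case: (b g x).
by apply: computes_rec; comp.
Qed.

End Arithmetic.

#[local] Hint Resolve computes_pred computes_add computes_if computes_and
  computes_not : comp.

Section Arithmetic2.
Local Open Scope nat_scope.
Variables F G : (nat -> nat) -> nat -> nat.
Hypotheses (cF : computes F) (cG : computes G).

Lemma computes_sub : computes (fun g x => F g x - G g x).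
Proof.
apply: (@computes_ext
  (fun g x => nat_rec (fun=> nat) (F g x) (fun _ y => y.-1) (G g x))).
  by move=> g x; elim: (G g x) => [|n /= ->]; rewrite ?subn0 ?subnS.
by apply: computes_rec; comp.
Qed.

Lemma computes_mul : computes (fun g x => F g x * G g x).
Proof.
apply: (@computes_ext
  (fun g x => nat_rec (fun=> nat) 0 (fun _ y => F g x + y) (G g x))).
  by move=> g x; elim: (G g x) => [|n /= ->]; rewrite ?muln0 ?mulnS.
by apply: computes_rec; comp.
Qed.

End Arithmetic2.
#[local] Hint Resolve computes_sub computes_mul : comp.

Section Arithmetic3.
Local Open Scope nat_scope.
Variables F G : (nat -> nat) -> nat -> nat.
Hypotheses (cF : computes F) (cG : computes G).

Lemma computes_exp : computes (fun g x => F g x ^ G g x).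
Proof.
apply: (@computes_ext
  (fun g x => nat_rec (fun=> nat) 1 (fun _ y => F g x * y) (G g x))).
  by move=> g x; elim: (G g x) => [|n /= ->]; rewrite ?expn0 ?expnS.
by apply: computes_rec; comp.
Qed.

Lemma computes_leq : computes (fun g x => F g x <= G g x).
Proof.
apply: (@computes_ext (fun g x => 1 - (F g x - G g x))); last by comp.
by move=> g x; rewrite /leq; case: (F g x - G g x).
Qed.

Lemma computes_odd : computes (fun g x => odd (F g x)).
Proof.
apply: (@computes_ext
  (fun g x => nat_rec (fun=> nat) 0 (fun _ y => 1 - y) (F g x))).
  by move=> g x; elim: (F g x) => [|n /= ->] //; case: (odd n).
by apply: computes_rec; comp.
Qed.

End Arithmetic3.
#[local] Hint Resolve computes_exp computes_leq computes_odd : comp.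

Section BoundedSearch.
Local Open Scope nat_scope.
Variables F G : (nat -> nat) -> nat -> nat.
Hypotheses (cF : computes F) (cG : computes G).

Lemma computes_or (b d : (nat -> nat) -> nat -> bool) :
  computes (fun g x => b g x) -> computes (fun g x => d g x) ->
  computes (fun g x => b g x || d g x).
Proof.
move=> cb cd; apply: (@computes_ext (fun g x => ~~ (~~ b g x && ~~ d g x))).
  by move=> g x; rewrite negb_and !negbK.
by comp.
Qed.
Hint Resolve computes_or : comp.

Lemma computes_eq : computes (fun g x => F g x == G g x).
Proof.
apply: (@computes_ext (fun g x => (F g x <= G g x) && (G g x <= F g x))).
  by move=> g x; rewrite eqn_leq.
by comp.
Qed.

Variable P : (nat -> nat) -> nat -> nat -> bool.
Hypothesis cP : computes (fun g p => P g (pr1 p) (pr2 p)).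

Lemma computes_pred2 A B : computes A -> computes B ->
  computes (fun g x => P g (A g x) (B g x)).
Proof.
move=> cA cB; have := computes_comp _ _ cP (computes_pr _ _ cA cB).
by apply: computes_ext => g x; rewrite pr1_pr pr2_pr.
Qed.

Lemma computes_count : computes (fun g x => count (P g x) (iota 0 (F g x))).
Proof.
apply: (@computes_ext
  (fun g x => nat_rec (fun=> nat) 0 (fun k y => y + P g x k) (F g x))).
  move=> g x; elim: (F g x) => [//|n IHn].
  by rewrite -[in RHS]addn1 iotaD count_cat /= IHn add0n addn0.
apply: computes_rec; comp.
by have := computes_pred2 (fun _ => pr1) (fun _ p => pr1 (pr2 p)); comp.
Qed.

Lemma computes_has : computes (fun g x => has (P g x) (iota 0 (F g x))).
Proof.
apply: (@computes_ext (fun g x => 0 < count (P g x) (iota 0 (F g x)))).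
  by move=> g x; rewrite has_count.
have := computes_count => cC.
have : computes (fun g x => 1 - (1 - count (P g x) (iota 0 (F g x)))) by comp.
by apply: computes_ext => g x; case: count.
Qed.

(** Bounded minimisation: the accumulator is the answer for the range scanned
    so far, and it is smaller than that range only if the search succeeded. *)
Lemma computes_find : computes (fun g x => find (P g x) (iota 0 (F g x))).
Proof.
apply: (@computes_ext (fun g x => nat_rec (fun=> nat) 0
    (fun k y => if (y < k) || P g x k then y else k.+1) (F g x))).
  move=> g x; elim: (F g x) => [//|n IHn].
  rewrite -[in RHS]addn1 iotaD find_cat /= IHn add0n size_iota.
  have := has_find (P g x) (iota 0 n); rewrite size_iota => <-.
  case: (boolP (has _ (iota 0 n))) => //= hs; rewrite hasNfind // size_iota.
  by case: (P g x n); rewrite ?addn0 ?addn1.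
apply: computes_rec; comp.
have cY : computes (fun g p => P g (pr1 p) (pr1 (pr2 p))).
  by apply: computes_pred2; comp.
by comp.
Qed.

End BoundedSearch.

#[local] Hint Resolve computes_or computes_eq computes_count computes_has
  computes_find : comp.

Section Division.
Local Open Scope nat_scope.
Variables F G : (nat -> nat) -> nat -> nat.
Hypotheses (cF : computes F) (cG : computes G).

Lemma computes_div : computes (fun g x => F g x %/ G g x).
Proof.
apply: (@computes_ext (fun g x => if G g x == 0 then 0 else
   count (fun k => k.+1 * G g x <= F g x) (iota 0 (F g x)))); last by comp.
move=> g x; case: eqP => [->|/eqP]; first by rewrite divn0.
rewrite -lt0n; move: (F g x) (G g x) => m d d0.
rewrite (eq_count (a2 := fun k => k < m %/ d)) => [|k /=]; last by rewrite leq_divRL.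
suff H n q : q <= n -> count (fun k => k < q) (iota 0 n) = q.
  by rewrite H // leq_div.
move=> qn; rewrite -(subnKC qn) iotaD count_cat add0n.
rewrite (eq_in_count (a2 := xpredT)) => [|k]; last by rewrite mem_iota.
rewrite count_predT size_iota (eq_in_count (a2 := pred0)) ?count_pred0 ?addn0 //.
by move=> k; rewrite mem_iota => /andP[+ _] /=; rewrite leqNgt => /negbTE.
Qed.

End Division.
#[local] Hint Resolve computes_div : comp.

Lemma computes_mod F G : computes F -> computes G ->
  computes (fun g x => F g x %% G g x)%N.
Proof.
move=> cF cG.
apply: (@computes_ext (fun g x => F g x - F g x %/ G g x * G g x)%N); last by comp.
by move=> g x; rewrite {1}(divn_eq (F g x) (G g x)) addKn.
Qed.
#[local] Hint Resolve computes_mod : comp.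

(** * A machine that runs all functionals step by step *)

Section Machine.
Local Open Scope nat_scope.

Fixpoint code_num (c : code) : nat :=
  match c with
  | CZero => pr 0 0
  | CSucc => pr 1 0
  | CFst => pr 2 0
  | CSnd => pr 3 0
  | COracle => pr 4 0
  | CPair c d => pr 5 (pr (code_num c) (code_num d))
  | CComp c d => pr 6 (pr (code_num c) (code_num d))
  | CPrec c d => pr 7 (pr (code_num c) (code_num d))
  | CMin c => pr 8 (code_num c)
  end.

(** The machine evaluates the function numbered [e] at [x], or returns a value
    [y], to a stack [K] of suspended computations.  The stack is a number: 0
    when empty, and the successor of a pair otherwise. *)
Definition Run e x K := pr 0 (pr (pr e x) K).
Definition Ret y K := pr 1 (pr y K).
Definition push f K := (pr f K).+1.

(** The oracle instruction (tag 4) answers 0, the value of the zero oracle.  A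
    number [e] that encodes no functional gives some meaningless run. *)
Definition step_run e x K :=
  let t := pr1 e in let a := pr1 (pr2 e) in let b := pr2 (pr2 e) in
  if t == 0 then Ret 0 K else
  if t == 1 then Ret x.+1 K else
  if t == 2 then Ret (pr1 x) K else
  if t == 3 then Ret (pr2 x) K else
  if t == 4 then Ret 0 K else
  if t == 5 then Run a x (push (pr 0 (pr b x)) K) else
  if t == 6 then Run b x (push (pr 2 a) K) else
  if t == 7 then
    if pr2 x == 0 then Run a (pr1 x) K
    else Run e (pr (pr1 x) (pr2 x).-1)
           (push (pr 3 (pr b (pr (pr1 x) (pr2 x).-1))) K)
  else Run (pr2 e) (pr x 0) (push (pr 4 (pr (pr2 e) (pr x 0))) K).

Definition step_ret y f K :=
  let t := pr1 f in let v := pr2 f in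
  let a := pr1 v in let x := pr1 (pr2 v) in let n := pr2 (pr2 v) in
  if t == 0 then Run a (pr2 v) (push (pr 1 y) K) else
  if t == 1 then Ret (pr v y) K else
  if t == 2 then Run v y K else
  if t == 3 then Run a (pr x (pr n y)) K
  else if y == 0 then Ret n K
       else Run a (pr x n.+1) (push (pr 4 (pr a (pr x n.+1))) K).

Definition step st :=
  let v := pr1 (pr2 st) in let K := pr2 (pr2 st) in
  if pr1 st == 0 then step_run (pr1 v) (pr2 v) K
  else if K == 0 then st else step_ret v (pr1 K.-1) (pr2 K.-1).

Definition halted st := (pr1 st == 1) && (pr2 (pr2 st) == 0).

Definition halts_by e x n := halted (iter n step (Run e x 0)).

Lemma computes_halts_by E X N : computes E -> computes X -> computes N ->
  computes (fun g x => halts_by (E g x) (X g x) (N g x)).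
Proof.
move=> cE cX cN.
pose I g x := nat_rec (fun=> nat) (Run (E g x) (X g x) 0) (fun _ => step) (N g x).
have cI : computes I.
  apply: computes_rec; rewrite /Run; comp.
  by rewrite /step /step_run /step_ret /Run /Ret /push; comp.
apply: (@computes_ext (fun g x => halted (I g x))); last by rewrite /halted; comp.
by move=> g x; rewrite /halts_by /I; congr (nat_of_bool (halted _));
  elim: (N g x) => //= n ->.
Qed.

Lemma step_Run e x K : step (Run e x K) = step_run e x K.
Proof. by rewrite /step /Run !(pr1_pr, pr2_pr). Qed.

Lemma step_Ret y f K : step (Ret y (push f K)) = step_ret y f K.
Proof. by rewrite /step /Ret /push !(pr1_pr, pr2_pr) /= ?(pr1_pr, pr2_pr). Qed.

Lemma halted_Ret y : halted (Ret y 0).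
Proof. by rewrite /halted /Ret !(pr1_pr, pr2_pr). Qed.

Lemma halted_Run e x K : halted (Run e x K) = false.
Proof. by rewrite /halted /Run !(pr1_pr, pr2_pr). Qed.

Lemma halted_push y f K : halted (Ret y (push f K)) = false.
Proof. by rewrite /halted /Ret /push !(pr1_pr, pr2_pr). Qed.

Lemma step_halted st : halted st -> step st = st.
Proof. by case/andP => /eqP h1 /eqP h2; rewrite /step h1 h2. Qed.

Lemma halts_by_mono e x m n : m <= n -> halts_by e x m -> halts_by e x n.
Proof.
move=> mn; rewrite /halts_by -(subnK mn) iterD.
by elim: (n - m) => //= k IHk /IHk h; rewrite step_halted.
Qed.

Let stepE := (step_Run, step_Ret, pr1_pr, pr2_pr).

Definition reaches st st' := exists n, iter n step st = st'.

Lemma reaches_trans s1 s2 s3 : reaches s1 s2 -> reaches s2 s3 -> reaches s1 s3.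
Proof. by move=> [m <-] [n <-]; exists (n + m); rewrite iterD. Qed.

Lemma reaches_step st st' : reaches (step st) st' -> reaches st st'.
Proof. by move=> [n <-]; exists n.+1; rewrite iterSr. Qed.

(** By induction on the derivation of [eval]; the stack is arbitrary, as
    subcomputations run on top of suspended ones. *)
Lemma machine_complete g c x y : (forall k, g k = 0) -> eval g c x y ->
  forall K, reaches (Run (code_num c) x K) (Ret y K).
Proof.
move=> g0; elim.
- by move=> {}x K; exists 1; rewrite /= stepE /step_run !stepE.
- by move=> {}x K; exists 1; rewrite /= stepE /step_run !stepE.
- by move=> {}x K; exists 1; rewrite /= stepE /step_run !stepE.
- by move=> {}x K; exists 1; rewrite /= stepE /step_run !stepE.
- by move=> {}x K; exists 1; rewrite /= stepE /step_run !stepE g0.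
- move=> {c x y} c d x y z _ IHc _ IHd K.
  apply: reaches_step; rewrite stepE /step_run /= !stepE /=.
  apply: reaches_trans (IHc _) _.
  apply: reaches_step; rewrite stepE /step_ret /= !stepE /=.
  apply: reaches_trans (IHd _) _.
  by exists 1; rewrite /= stepE /step_ret !stepE.
- move=> {c x y} c d x y z _ IHd _ IHc K.
  apply: reaches_step; rewrite stepE /step_run /= !stepE /=.
  apply: reaches_trans (IHd _) _.
  by apply: reaches_step; rewrite stepE /step_ret /= !stepE /=; exact: IHc.
- move=> {c x y} c d x y _ IHc K.
  by apply: reaches_step; rewrite stepE /step_run /= !stepE /=; exact: IHc.
- move=> {c x y} c d x n y z _ IH1 _ IH2 K.
  apply: reaches_step; rewrite stepE /step_run /= !stepE /=.
  apply: reaches_trans (IH1 _) _.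
  by apply: reaches_step; rewrite stepE /step_ret /= !stepE /=; exact: IH2.
- move=> {c x y} c x n k _ IHk _ IHn K.
  apply: reaches_step; rewrite stepE /step_run /= !stepE /=.
  pose st m := Run (code_num c) (pr x m) (push (pr 4 (pr (code_num c) (pr x m))) K).
  have: forall m, m <= n -> reaches (st 0) (st m).
    elim=> [_|m IHm mn]; first by exists 0.
    apply: reaches_trans (IHm (ltnW mn)) _; apply: reaches_trans (IHk m mn _) _.
    by exists 1; rewrite /= stepE /step_ret !stepE.
  move=> /(_ n (leqnn n)) /reaches_trans; apply; apply: reaches_trans (IHn _) _.
  by exists 1; rewrite /= stepE /step_ret !stepE.
Qed.

Lemma halted_iterS n st : halted st = false -> halted (iter n step st) ->
  exists2 m, n = m.+1 & halted (iter m step (step st)).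
Proof. by case: n => [/= -> //|m _]; rewrite iterSr; exists m. Qed.

(** A halting run on top of a stack [K] must first return a value to [K], in
    fewer steps.  Recursion on the code therefore suffices, except for
    minimisation, whose rounds are counted down by the number of steps left. *)
Lemma machine_sound c n x K : halted (iter n step (Run (code_num c) x K)) ->
  exists y m, [/\ eval0 c x y, m < n & halted (iter m step (Ret y K))].
Proof.
elim: c n x K => [||||| c IHc d IHd | c IHc d IHd | c IHc d IHd | c IHc] n x K;
  move=> /(halted_iterS _ _ (halted_Run _ _ _)) [{}n ->];
  rewrite stepE /step_run /= ?stepE /=.
- by move=> h; exists 0, n; split=> //; constructor.
- by move=> h; exists x.+1, n; split=> //; constructor.
- by move=> h; exists (pr1 x), n; split=> //; constructor.
- by move=> h; exists (pr2 x), n; split=> //; constructor.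
- by move=> h; exists 0, n; split=> //; exact: (@EOracle (fun=> 0)).
- move=> /IHc [y [m [cy mn]]] /(halted_iterS _ _ (halted_push _ _ _)) [m' em].
  rewrite stepE /step_ret /= ?stepE /= => /IHd [z [p [dz pm]]].
  move=> /(halted_iterS _ _ (halted_push _ _ _)) [p' ep].
  rewrite stepE /step_ret /= ?stepE /= => h; exists (pr y z), p'; split=> //.
    exact: EPair cy dz.
  by rewrite em ep in pm mn; rewrite ltnS; lia.
- move=> /IHd [y [m [dy mn]]] /(halted_iterS _ _ (halted_push _ _ _)) [m' em].
  rewrite stepE /step_ret /= ?stepE /= => /IHc [z [p [cz pm]]] h.
  by exists z, p; split=> //; [exact: EComp dy cz | lia].
- rewrite -[X in eval0 _ X](pr_eta x); move: (pr1 x) (pr2 x) => {}x k.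
  elim: k n K => [|k IHk] n K /=.
    move=> /IHc [y [m [cy mn]]] h.
    by exists y, m; split=> //; [exact: EPrec0|lia].
  move=> /(halted_iterS _ _ (halted_Run _ _ _)) [{}n ->].
  rewrite stepE /step_run /= ?stepE /= => /IHk [y [m [cy mn]]].
  move=> /(halted_iterS _ _ (halted_push _ _ _)) [m' em].
  rewrite stepE /step_ret /= ?stepE /= => /IHd [z [p [dz pm]]] h.
  by exists z, p; split=> //; [exact: EPrecS cy dz | lia].
- (* [N] bounds the steps left when round [m] of the search begins. *)
  have loop N : forall m, halted (iter N step
      (Run (code_num c) (pr x m) (push (pr 4 (pr (code_num c) (pr x m))) K))) ->
    exists k p, [/\ m <= k, forall i, m <= i < k -> exists y, eval0 c (pr x i) y.+1,
      eval0 c (pr x k) 0, p < N & halted (iter p step (Ret k K))].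
    elim/ltn_ind: N => N IHN m /IHc [y [p [cy pN]]].
    move=> /(halted_iterS _ _ (halted_push _ _ _)) [p' ep].
    rewrite stepE /step_ret /= ?stepE /=; case: y cy => [|y] cy /= h.
      by exists m, p'; split=> // [i|]; lia.
    have [|k [q [mk ki ck qp hq]]] := IHN p' _ m.+1 h; first by lia.
    exists k, q; split=> // [|i|]; [lia| |lia].
    move=> /andP[]; rewrite leq_eqVlt => /predU1P[<- _|mi ik]; first by exists y.
    by apply: ki; rewrite mi.
  move=> /loop [k [p [_ ki ck pn h]]]; exists k, p; split=> //; last by lia.
  have /choice [f fP] : forall i, exists y, i < k -> eval0 c (pr x i) y.+1.
    move=> i; have [ik|] := boolP (i < k); last by exists 0.
    by have [y ?] := ki i ik; exists y.
  exact: (@EMin _ _ _ _ f).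
Qed.

Lemma halts_byP c x :
  (exists n, halts_by (code_num c) x n) <-> exists y, eval0 c x y.
Proof.
split=> [[n /machine_sound[y [m []]]] | [y cy]]; first by exists y.
have [|n hn] := @machine_complete (fun=> 0) c x y _ cy 0; first by [].
by exists n; rewrite /halts_by hn halted_Ret.
Qed.

End Machine.
#[local] Hint Resolve computes_halts_by : comp.

(** * Arithmetic on codes of rationals *)

Section RationalCodes.

Definition ratc p q d := pr (pr p q) d.-1.
Definition fracc p d := ratc p 0 d.
Definition oppc a := pr (pr (pr2 (pr1 a)) (pr1 (pr1 a))) (pr2 a).
Definition addc a b :=
  ratc (pr1 (pr1 a) * (pr2 b).+1 + pr1 (pr1 b) * (pr2 a).+1)%N
       (pr2 (pr1 a) * (pr2 b).+1 + pr2 (pr1 b) * (pr2 a).+1)%N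
       ((pr2 a).+1 * (pr2 b).+1)%N.
Definition ltc a b :=
  (pr1 (pr1 a) * (pr2 b).+1 + pr2 (pr1 b) * (pr2 a).+1 <
   pr1 (pr1 b) * (pr2 a).+1 + pr2 (pr1 a) * (pr2 b).+1)%N.
Definition absc a := if ltc a (fracc 0 1) then oppc a else a.

Lemma rat_of_ratc p q d : (0 < d)%N ->
  rat_of_code (ratc p q d) = (p%:R - q%:R) / d%:R.
Proof.
by move=> d0; rewrite /rat_of_code /ratc !pr1_pr !pr2_pr prednK.
Qed.

Lemma rat_of_fracc p d : (0 < d)%N -> rat_of_code (fracc p d) = p%:R / d%:R.
Proof. by move=> d0; rewrite rat_of_ratc // subr0. Qed.

Lemma rat_of_oppc a : rat_of_code (oppc a) = - rat_of_code a.
Proof. by rewrite /rat_of_code /oppc !pr1_pr !pr2_pr -mulNr opprB. Qed.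

Lemma rat_of_addc a b :
  rat_of_code (addc a b) = rat_of_code a + rat_of_code b.
Proof.
rewrite rat_of_ratc ?muln_gt0 // /rat_of_code !(natrD, natrM).
have a0 : (pr2 a).+1%:R != 0 :> rat by rewrite pnatr_eq0.
have b0 : (pr2 b).+1%:R != 0 :> rat by rewrite pnatr_eq0.
by field; rewrite ?(addrC 1) ?natr1 a0 b0.
Qed.

Lemma rat_of_ltc a b : ltc a b = (rat_of_code a < rat_of_code b).
Proof.
rewrite /rat_of_code ltr_pdivrMr ?ltr0n // mulrAC ltr_pdivlMr ?ltr0n //.
by rewrite !mulrBl ltrBlDr addrAC ltrBrDr -!natrM -!natrD ltr_nat.
Qed.

Lemma rat_of_absc a : rat_of_code (absc a) = `|rat_of_code a|.
Proof.
rewrite /absc rat_of_ltc rat_of_fracc // mul0r.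
by case: ltP => h; [rewrite rat_of_oppc ltr0_norm | rewrite ger0_norm].
Qed.

Section Computes.
Local Open Scope nat_scope.
Variables F G : (nat -> nat) -> nat -> nat.
Hypotheses (cF : computes F) (cG : computes G).

Lemma computes_fracc : computes (fun g x => fracc (F g x) (G g x)).
Proof. by rewrite /fracc /ratc; comp. Qed.
Lemma computes_oppc : computes (fun g x => oppc (F g x)).
Proof. by rewrite /oppc; comp. Qed.
Lemma computes_addc : computes (fun g x => addc (F g x) (G g x)).
Proof. by rewrite /addc /ratc; comp. Qed.
Lemma computes_ltc : computes (fun g x => ltc (F g x) (G g x)).
Proof. by rewrite /ltc; comp. Qed.
End Computes.
Hint Resolve computes_fracc computes_oppc computes_ltc : comp.
Lemma computes_absc F : computes F -> computes (fun g x => absc (F g x)).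
Proof. by move=> cF; rewrite /absc; comp. Qed.
End RationalCodes.

#[local] Hint Resolve computes_fracc computes_oppc computes_addc computes_ltc
  computes_absc : comp.

Section Semicomputable.
Variable R : realType.
Implicit Types (f : R -> R) (x : R).

(** It is enough to compute, from a name of [x], rationals whose supremum is
    [f x]: their running maximum minus 2^-n increases strictly and has the
    same limit. *)
Lemma lower_semicomputable_sup f P :
  computes P ->
  (forall x q g, cauchy_name q x -> (forall n, rat_of_code (g n) = q n) ->
    (forall k, ratr (rat_of_code (P g k)) <= f x) /\
    forall e, 0 < e -> exists k, f x - e < ratr (rat_of_code (P g k))) ->
  lower_semicomputable f.
Proof.
move=> cP fP.
pose M g n := nat_rec (fun=> nat) (P g 0)
  (fun k y => if ltc y (P g k.+1) then P g k.+1 else y) n.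
have cM : computes (fun g => M g).
  by apply: computes_rec; comp.
have [c cE] : computes (fun g n => addc (M g n) (oppc (fracc 1 (2 ^ n)))) by comp.
exists c => x q g qx gq; have [Ple Psup] := fP x q g qx gq.
pose m n := rat_of_code (M g n).
have mS n : m n.+1 = Num.max (m n) (rat_of_code (P g n.+1)).
  by rewrite /m /= rat_of_ltc; case: ltP.
have mle n : ratr (m n) <= f x.
  elim: n => [|n IHn]; first exact: Ple.
  by rewrite mS /Num.max; case: ifP => _ //; exact: Ple.
have mnd : {homo m : i j / (i <= j)%N >-> i <= j}.
  by apply: homo_leq => [||i]; [exact: lexx | exact: le_trans
    | rewrite mS le_max lexx].
have Pm k : rat_of_code (P g k) <= m k.
  by case: k => [|k] //; rewrite mS le_max lexx orbT.
pose r n := m n - 2^-1 ^+ n.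
have rE n : rat_of_code (addc (M g n) (oppc (fracc 1 (2 ^ n)))) = r n.
  by rewrite rat_of_addc rat_of_oppc rat_of_fracc ?expn_gt0 // natrX mul1r /r exprVn.
exists r; split=> [n||].
- by eexists; [exact: cE | rewrite rE].
- apply/(@increasing_seqP _ rat) => n; rewrite /r.
  apply: ler_ltD; first exact: mnd.
  by rewrite ltrN2 exprS gtr_pMl ?exprn_gt0 ?invr_gt0 // invf_lt1 // ltr1n.
- have lim0 : (ratr (2^-1 ^+ n) : R) @[n --> \oo] --> (0 : R).
    under eq_fun => n do rewrite rmorphXn fmorphV rmorph_nat.
    by apply: cvg_expr; rewrite ger0_norm ?invr_ge0 // invf_lt1 // ltr1n.
  under eq_fun => n do rewrite /r raddfB.
  rewrite -(subr0 (f x)); apply: cvgB lim0.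
  apply/cvgrPdist_lt => e e0; have [k kP] := Psup e e0.
  near=> n; rewrite ger0_norm ?subr_ge0 ?mle // ltrBlDr -ltrBlDl.
  apply: lt_le_trans kP _; rewrite ler_rat; apply: le_trans (Pm k) _.
  by apply: mnd; near: n; exact: nbhs_infty_ge.
Unshelve. all: by end_near.
Qed.

End Semicomputable.

(** * The tree of nested intervals *)

Section Tree.
Local Open Scope nat_scope.

(** A cell of level [i] is cut into [branching i] equal pieces, of which the
    outermost [margin i] on either side are discarded; the [inner i] others are
    its children.  The discarded proportion is 2^-(i+2), so that half of the unit
    interval survives at all levels, while [margin i] tends to infinity. *)
Definition margin i := 2 ^ i.
Definition branching i := margin i * 2 ^ i.+3.
Definition inner i := branching i - 2 * margin i.
Definition scale i := nat_rec (fun=> nat) 1 (fun j y => y * branching j) i.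
Definition nodes i := nat_rec (fun=> nat) 1 (fun j y => y * inner j) i.
(** The [nodes i] nodes of level [i] are numbered so that the children of [k]
    are the numbers with quotient [k] by [inner i]; [anc i j k] is the ancestor
    at level [j] of the node [k] of level [i]. *)
Definition anc i j k := k %/ (nodes i %/ nodes j).
Definition flip j d := if odd j then (inner j).-1 - d else d.
(** The cell of the node [k] of level [i] is the interval from [pos i k] to
    [pos i k + 1] in units of [1 / scale i].  Siblings are numbered from left to
    right below even levels and, through [flip], from right to left below odd
    levels. *)
Definition pos i k := nat_rec (fun=> nat) 0
  (fun j y => y * branching j + margin j + flip j (anc i j.+1 k %% inner j)) i.

Lemma margin_gt0 i : 0 < margin i. Proof. by rewrite expn_gt0. Qed.

Lemma branchingE i : branching i = margin i + inner i + margin i.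
Proof.
rewrite /inner /branching !expnS; have := margin_gt0 i.
have : 0 < 2 ^ i by rewrite expn_gt0.
by move: (margin i) (2 ^ i) => m p; nia.
Qed.

Lemma inner_gt0 i : 0 < inner i.
Proof.
rewrite /inner /branching !expnS; have := margin_gt0 i.
have : 0 < 2 ^ i by rewrite expn_gt0.
by move: (margin i) (2 ^ i) => m p; nia.
Qed.

Lemma nodesS i : nodes i.+1 = nodes i * inner i. Proof. by []. Qed.
Lemma scaleS i : scale i.+1 = scale i * branching i. Proof. by []. Qed.

Lemma nodes_gt0 i : 0 < nodes i.
Proof. by elim: i => // i IHi; rewrite nodesS muln_gt0 IHi inner_gt0. Qed.

Lemma scale_gt0 i : 0 < scale i.
Proof.
elim: i => // i IHi; rewrite scaleS muln_gt0 IHi branchingE.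
by have := inner_gt0 i; lia.
Qed.

Lemma scale_gt i : i <= scale i.
Proof.
elim: i => // i IHi; rewrite scaleS branchingE.
by have := inner_gt0 i; have := margin_gt0 i; have := scale_gt0 i; nia.
Qed.

(** The surviving proportion is at least (1 + 2^-i) / 2, which is what the
    induction needs: passing to the next level multiplies it by
    1 - 2^-(i+2). *)
Lemma half_nodes i : scale i <= 2 * nodes i.
Proof.
suff : scale i * (2 ^ i).+1 <= nodes i * 2 ^ i.+1.
  rewrite expnS mulnS mulnCA => h.
  have : scale i * 2 ^ i <= 2 * nodes i * 2 ^ i by lia.
  by rewrite leq_pmul2r ?expn_gt0.
elim: i => // i IHi.
rewrite nodesS scaleS !expnS in IHi *.
have : branching i * (2 * 2 ^ i).+1 <= 2 * inner i * (2 ^ i).+1.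
  rewrite /inner /branching !expnS; have := margin_gt0 i.
  have : 0 < 2 ^ i by rewrite expn_gt0.
  by move: (margin i) (2 ^ i) => m p; nia.
move: (2 ^ i) (branching i) (inner i) (scale i) (nodes i) IHi => p b n s t h1 h2.
have {}h1 := leq_mul (leqnn (2 * n)) h1; have {}h2 := leq_mul (leqnn s) h2.
by lia.
Qed.

Lemma dvdn_nodes i j : j <= i -> nodes j %| nodes i.
Proof.
move=> /subnK <-; elim: (i - j) => // n IHn.
by rewrite addSn nodesS dvdn_mulr.
Qed.

Lemma ancn i k : anc i i k = k.
Proof. by rewrite /anc divnn nodes_gt0 divn1. Qed.

Lemma ancS i j k : j <= i -> anc i.+1 j k = anc i j (k %/ inner i).
Proof.
by move=> ji; rewrite /anc nodesS mulnC -muln_divA ?dvdn_nodes // divnMA.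
Qed.

Lemma anc_lt i j k : j <= i -> k < nodes i -> anc i j k < nodes j.
Proof.
move=> /subnK <-; elim: (i - j) k => [|n IHn] k; first by rewrite ancn.
rewrite addSn ancS ?leq_addl // nodesS => kn; apply: IHn.
by rewrite ltn_divLR ?inner_gt0.
Qed.

Lemma anc_div i j k : j < i -> anc i j.+1 k %/ inner j = anc i j k.
Proof.
move=> /subnK <-; elim: (i - j.+1) k => [|n IHn] k.
  by rewrite add0n ancn ancS // ancn.
by rewrite addSn !(ancS (n + j.+1)) ?IHn //; lia.
Qed.

Lemma anc_anc i j l k : l <= j <= i -> anc j l (anc i j k) = anc i l k.
Proof.
move=> /andP[lj /subnK <-]; elim: (i - j) k => [|n IHn] k; first by rewrite ancn.
by rewrite addSn !(ancS (n + j)) ?IHn //; lia.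
Qed.

Lemma leq_anc i j k l : k <= l -> anc i j k <= anc i j l.
Proof. by move=> kl; rewrite /anc leq_div2r. Qed.

(** The definition of [pos] recurses upwards on the level for a fixed leaf, the
    form in which it is primitive recursive; this is the recursion along the
    branch. *)
Lemma posS i k : pos i.+1 k =
  pos i (k %/ inner i) * branching i + margin i + flip i (k %% inner i).
Proof.
rewrite {1}/pos /= ancn; congr (_ * _ + _ + _); rewrite /pos.
set f := (X in nat_rec _ _ X); set g := (X in _ = nat_rec _ _ X _).
suff fg j : j <= i -> nat_rec (fun=> nat) 0 f j = nat_rec (fun=> nat) 0 g j by exact: fg.
elim: j => //= j IHj ji; rewrite IHj ?(ltnW ji) // /f /g.
by rewrite ancS.
Qed.

Lemma flip_lt i k : flip i (k %% inner i) < inner i.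
Proof.
by rewrite /flip; have := ltn_pmod k (inner_gt0 i); case: odd => //; lia.
Qed.

Lemma pos_ge i k : pos i (k %/ inner i) * branching i + margin i <= pos i.+1 k.
Proof. by rewrite posS leq_addr. Qed.

Lemma pos_le i k :
  pos i.+1 k + 1 + margin i <= (pos i (k %/ inner i) + 1) * branching i.
Proof.
by rewrite posS mulnDl mul1n [X in _ <= _ + X]branchingE; have := flip_lt i k; lia.
Qed.

Lemma pos_lt i k l : k %/ inner i = l %/ inner i -> k < l ->
  if odd i then pos i.+1 l < pos i.+1 k else pos i.+1 k < pos i.+1 l.
Proof.
move=> kl; rewrite {1}(divn_eq k (inner i)) {1}(divn_eq l (inner i)) kl !posS kl.
rewrite ltn_add2l /flip !ltn_add2l.
have := ltn_pmod l (inner_gt0 i); have := ltn_pmod k (inner_gt0 i).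
by case: odd; lia.
Qed.

Lemma pos_inj i k l : k < nodes i -> l < nodes i -> pos i k = pos i l -> k = l.
Proof.
elim: i k l => [|i IHi] k l; first by case: k l => [|k] [|l].
rewrite nodesS => kn ln.
have [kl|nkl] := eqVneq (k %/ inner i) (l %/ inner i) => e.
  have [||//] := ltngtP k l => h.
    by have := pos_lt _ _ _ kl h; rewrite e ltnn; case: odd.
  by have := pos_lt _ _ _ (esym kl) h; rewrite e ltnn; case: odd.
case/eqP: nkl; apply: IHi; rewrite ?ltn_divLR ?inner_gt0 //.
have := pos_ge i k; have := pos_le i k; have := pos_ge i l; have := pos_le i l.
rewrite e; have := margin_gt0 i; move: (pos i.+1 l) (pos i _) (pos i _) => p x y.
by have [xy|xy|//] := ltngtP x y; nia.
Qed.

Lemma pos_scale i k : pos i k + 1 <= scale i.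
Proof.
elim: i k => // i IHi k; rewrite scaleS.
apply: leq_trans (leq_mul (IHi (k %/ inner i)) (leqnn _)).
by apply: leq_trans (pos_le i k); lia.
Qed.

End Tree.

Section TreeComputes.
Local Open Scope nat_scope.
Lemma computes_margin F : computes F -> computes (fun g x => margin (F g x)).
Proof. by move=> cF; rewrite /margin; comp. Qed.
Hint Resolve computes_margin : comp.
Lemma computes_branching F : computes F -> computes (fun g x => branching (F g x)).
Proof. by move=> cF; rewrite /branching; comp. Qed.
Hint Resolve computes_branching : comp.
Lemma computes_inner F : computes F -> computes (fun g x => inner (F g x)).
Proof. by move=> cF; rewrite /inner; comp. Qed.
Hint Resolve computes_inner : comp.
Lemma computes_scale F : computes F -> computes (fun g x => scale (F g x)).
Proof. by move=> cF; apply: computes_rec; comp. Qed.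
Lemma computes_nodes F : computes F -> computes (fun g x => nodes (F g x)).
Proof. by move=> cF; apply: computes_rec; comp. Qed.
Hint Resolve computes_nodes : comp.
Lemma computes_anc F G H : computes F -> computes G -> computes H ->
  computes (fun g x => anc (F g x) (G g x) (H g x)).
Proof. by move=> cF cG cH; rewrite /anc; comp. Qed.
Hint Resolve computes_anc : comp.
Lemma computes_pos F G : computes F -> computes G ->
  computes (fun g x => pos (F g x) (G g x)).
Proof. by move=> cF cG; apply: computes_rec; rewrite /flip; comp. Qed.
End TreeComputes.
#[local] Hint Resolve computes_margin computes_branching computes_inner
  computes_scale computes_nodes computes_anc computes_pos : comp.

(** * The first branch that avoids the trimmed tests *)

Section Search.
Local Open Scope nat_scope.

Lemma count_iota_div (P : pred nat) n d : 0 < d ->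
  count (fun k => P (k %/ d)) (iota 0 (n * d)) = count P (iota 0 n) * d.
Proof.
move=> d0; elim: n => // n IHn.
rewrite mulSnr iotaD count_cat IHn -[in RHS]addn1 iotaD count_cat mulnDl !add0n /=.
congr (_ + _); rewrite addn0.
have -> : count (fun k => P (k %/ d)) (iota (n * d) d) =
          count (fun _ => P n) (iota (n * d) d).
  apply: eq_in_count => k; rewrite mem_iota => /andP[nk kn]; congr P.
  by apply/eqP; rewrite eqn_leq leq_divRL // nk andbT -ltnS ltn_divLR // mulSnr.
by case: (P n); rewrite ?count_predT ?count_pred0 ?size_iota ?mul1n.
Qed.

Variable hit : nat -> nat -> nat -> bool.
(* [hit e s k]: the e-th test covers the cell [k] of level [s] by stage [s]. *)
Hypothesis hitS : forall e s k, hit e s (k %/ inner s) -> hit e s.+1 k.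

Definition active e s := count (hit e s) (iota 0 (nodes s)) * 2 ^ e.+2 <= nodes s.
(** All earlier stages are consulted, because a test that gets ignored at some
    stage must keep what it has struck before. *)
Definition struck e s k :=
  has (fun t => active e t && hit e t (anc s t k)) (iota 0 s.+1).
Definition bad s k := has (fun e => struck e s k) (iota 0 s).
Definition least s := find (fun k => ~~ bad s k) (iota 0 (nodes s)).

Lemma struckP e s k :
  reflect (exists t, [/\ t <= s, active e t & hit e t (anc s t k)]) (struck e s k).
Proof.
apply: (iffP hasP) => [[t]|[t [ts h1 h2]]].
  by rewrite mem_iota ltnS => ts /andP[h1 h2]; exists t.
by exists t; rewrite ?mem_iota ?ltnS ?h1.
Qed.

Lemma badP s k : reflect (exists2 e, e < s & struck e s k) (bad s k).
Proof.
apply: (iffP hasP) => [[e]|[e es h]]; rewrite ?mem_iota; first by exists e.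
by exists e; rewrite ?mem_iota.
Qed.

Lemma hit_anc e s t k : t <= s -> hit e t (anc s t k) -> hit e s k.
Proof.
move=> /subnK <-; elim: (s - t) k => [|n IHn] k; first by rewrite ancn.
by rewrite addSn ancS ?leq_addl // => /IHn /hitS.
Qed.

Lemma bad_anc s t k : t <= s -> bad t (anc s t k) -> bad s k.
Proof.
move=> ts /badP[e et /struckP[r [rt h1 h2]]]; apply/badP; exists e.
  exact: leq_trans et ts.
apply/struckP; exists r; split=> //; first exact: leq_trans rt ts.
by rewrite -(anc_anc s t) ?rt.
Qed.

(** If the test is active at the last stage, it has struck there all that it
    ever struck; otherwise it has struck nothing new, and the proportion does not
    change from one level to the next. *)
Lemma count_struck e s : count (struck e s) (iota 0 (nodes s)) * 2 ^ e.+2 <= nodes s.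
Proof.
elim: s => [|s IHs].
  have [a|na] := boolP (active e 0).
    apply: leq_trans a; rewrite leq_mul2r; apply/orP; right.
    apply: sub_count => k /struckP[t []]; rewrite leqn0 => /eqP -> _.
    by rewrite ancn.
  rewrite (@eq_count _ _ pred0) ?count_pred0 // => k; apply/struckP => -[t []].
  by rewrite leqn0 => /eqP ->; rewrite (negbTE na).
have [a|na] := boolP (active e s.+1).
  apply: leq_trans a; rewrite leq_mul2r; apply/orP; right.
  by apply: sub_count => k /struckP[t [ts _]]; exact: hit_anc.
apply: (@leq_trans (count (struck e s) (iota 0 (nodes s)) * inner s * 2 ^ e.+2)).
  rewrite leq_mul2r -(count_iota_div _ _ _ (inner_gt0 s)) -nodesS.
  apply/orP; right; apply: sub_count => k /struckP[t [ts ta ht]].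
  have {}ts : t <= s.
    by move: ts; rewrite leq_eqVlt => /predU1P[te|//]; rewrite -te ta in na.
  by apply/struckP; exists t; split=> //; rewrite -ancS.
by rewrite mulnAC nodesS leq_mul2r IHs orbT.
Qed.

(** The tests below [s] strike at most a proportion
    1/4 + 1/8 + ... < 1/2 of the nodes. *)
Lemma least_spec s : least s < nodes s /\ ~~ bad s (least s).
Proof.
suff ex : has (fun k => ~~ bad s k) (iota 0 (nodes s)).
  have lt : least s < nodes s.
    by move: ex; rewrite has_find size_iota.
  by split=> //; have := nth_find 0 ex; rewrite nth_iota.
have few m : count (fun k => has (fun e => struck e s k) (iota 0 m))
    (iota 0 (nodes s)) * 2 ^ m.+1 <= nodes s * (2 ^ m - 1).
  elim: m => [|m IHm]; first by rewrite count_pred0.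
  rewrite (_ : iota 0 m.+1 = iota 0 m ++ [:: m]); last by rewrite -addn1 iotaD.
  rewrite (@eq_count _ _ (predU (fun k => has (fun e => struck e s k) (iota 0 m))
     (struck m s))); last by move=> k; rewrite /= has_cat /= orbF.
  have := count_struck m s; rewrite !expnS in IHm *.
  have := count_predUI (fun k => has (fun e => struck e s k) (iota 0 m))
    (struck m s) (iota 0 (nodes s)).
  have : 0 < 2 ^ m by rewrite expn_gt0.
  move: IHm; case: (2 ^ m) => // p IHm _ cUI cm.
  set u := count (predU _ _) _ in cUI *.
  have ule : u <= count (fun k => has (fun e => struck e s k) (iota 0 m))
      (iota 0 (nodes s)) + count (struck m s) (iota 0 (nodes s)).
    by rewrite -cUI leq_addr.
  by have := leq_mul ule (leqnn (2 * (2 * p.+1))); nia.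
have lt : count (bad s) (iota 0 (nodes s)) < nodes s.
  have := few s; rewrite -/(bad s) expnS; have := nodes_gt0 s.
  have : 0 < 2 ^ s by rewrite expn_gt0.
  case: (2 ^ s) => // p _ n0; rewrite subn1 /=.
  by rewrite ltnNge => h; apply/negP => h'; nia.
by rewrite -[has _ _]/(has (predC (bad s)) _) has_predC all_count size_iota neq_ltn lt.
Qed.

Lemma least_le s k : k < nodes s -> ~~ bad s k -> least s <= k.
Proof.
move=> kn gk; rewrite leqNgt; apply/negP => kl.
by have := before_find 0 kl; rewrite nth_iota // gk.
Qed.

(** The ancestor of an unstruck node is unstruck, so the first unstruck node of a
    level is at most the ancestor of the first one of a later level. *)
Lemma leq_least s i t : i <= s <= t -> anc s i (least s) <= anc t i (least t).
Proof.
move=> /andP[is_ st]; have [lt gt] := least_spec t.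
rewrite -(anc_anc t s) ?is_ //; apply/leq_anc/least_le; first exact: anc_lt.
by apply: contra gt; exact: bad_anc.
Qed.

(** The limit, level by level, of the nondecreasing guesses
    [anc s i (least s)].  The guesses approach it from below in the numbering;
    together with the alternating orientation this produces the gaps. *)
Definition limit_branch (b : nat -> nat) := forall i,
  [/\ b i < nodes i,
      b i.+1 %/ inner i = b i,
      ~~ bad i (b i),
      forall s, i <= s -> anc s i (least s) <= b i
    & exists2 s0, i <= s0 & forall s, s0 <= s -> anc s i (least s) = b i].

Lemma limit_branch_exists : exists b, limit_branch b.
Proof.
have stab i : exists v, v < nodes i /\ exists2 s0, i <= s0 &
    forall s, s0 <= s -> anc s i (least s) = v.
  pose P v := `[< exists2 s, i <= s & anc s i (least s) = v >].
  have exP : exists v, P v.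
    by exists (anc i i (least i)); apply/asboolP; exists i.
  have ltP v : P v -> v <= nodes i.
    move=> /asboolP[s si <-]; apply/ltnW/anc_lt => //.
    by have [] := least_spec s.
  case: (ex_maxnP exP ltP) => v /asboolP[s0 is0 <-] vmax.
  exists (anc s0 i (least s0)); split.
    by apply: anc_lt => //; have [] := least_spec s0.
  exists s0 => // s s0s; apply/eqP; rewrite eqn_leq vmax ?leq_least ?is0 //.
  by apply/asboolP; exists s => //; exact: leq_trans s0s.
have [b bP] := choice stab; exists b => i.
have [bn [s0 is0 bs]] := bP i; have [_ [s1 is1 bs1]] := bP i.+1.
split=> //; last by exists s0.
- have m1 : s1 <= maxn s0 s1 by lia.
  rewrite -(bs1 _ m1) -(bs (maxn s0 s1)); last by lia.
  by rewrite anc_div //; lia.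
- rewrite -(bs s0 (leqnn _)); have [_] := least_spec s0.
  by apply: contra; exact: bad_anc.
- move=> s is_; rewrite -(bs (maxn s s0)); last by lia.
  by apply: leq_least; lia.
Qed.

End Search.

(** * Cells and the sequence of points *)

Section SearchComputes.
Local Open Scope nat_scope.
Variable hit : nat -> nat -> nat -> bool.
Hypothesis computes_hit : forall E S K, computes E -> computes S -> computes K ->
  computes (fun g x => hit (E g x) (S g x) (K g x)).
Hint Resolve computes_hit : comp.

Lemma computes_active E S : computes E -> computes S ->
  computes (fun g x => active hit (E g x) (S g x)).
Proof. by move=> cE cS; rewrite /active; comp. Qed.
Hint Resolve computes_active : comp.

Lemma computes_struck E S K : computes E -> computes S -> computes K ->
  computes (fun g x => struck hit (E g x) (S g x) (K g x)).
Proof. by move=> cE cS cK; rewrite /struck; comp. Qed.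
Hint Resolve computes_struck : comp.

Lemma computes_bad S K : computes S -> computes K ->
  computes (fun g x => bad hit (S g x) (K g x)).
Proof. by move=> cS cK; rewrite /bad; comp. Qed.
Hint Resolve computes_bad : comp.

Lemma computes_least S : computes S -> computes (fun g x => least hit (S g x)).
Proof. by move=> cS; rewrite /least; comp. Qed.

End SearchComputes.

Section Cells.

Definition cell_leftc s k := fracc (pos s k) (scale s).
Definition cell_rightc s k := fracc (pos s k).+1 (scale s).
Definition cell_left s k := rat_of_code (cell_leftc s k).
Definition cell_right s k := rat_of_code (cell_rightc s k).
(** The margin as a length: every cell of level [s.+1] keeps at least this
    distance from the ends of its parent. *)
Definition inset s : rat := (margin s)%:R / (scale s.+1)%:R.

Lemma cell_leftE s k : cell_left s k = (pos s k)%:R / (scale s)%:R.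
Proof. by rewrite /cell_left rat_of_fracc ?scale_gt0. Qed.

Lemma cell_rightE s k : cell_right s k = cell_left s k + (scale s)%:R^-1.
Proof. by rewrite cell_leftE /cell_right rat_of_fracc ?scale_gt0 // -natr1 mulrDl mul1r. Qed.

Lemma scaler_gt0 s : 0 < (scale s)%:R :> rat.
Proof. by rewrite ltr0n scale_gt0. Qed.

Lemma inset_gt0 s : 0 < inset s.
Proof. by rewrite divr_gt0 ?scaler_gt0 // ltr0n margin_gt0. Qed.

Lemma left_lt_right s k : cell_left s k < cell_right s k.
Proof. by rewrite cell_rightE ltrDl invr_gt0 scaler_gt0. Qed.

Lemma frac_scale p s : p%:R / (scale s)%:R = (p * branching s)%:R / (scale s.+1)%:R :> rat.
Proof.
rewrite scaleS !(natrM _ _ (branching s)) -mulf_div divff ?mulr1 // pnatr_eq0 branchingE.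
by have := margin_gt0 s; lia.
Qed.

Lemma left_inset s k : cell_left s (k %/ inner s) + inset s <= cell_left s.+1 k.
Proof.
rewrite !cell_leftE (frac_scale _ s) /inset -mulrDl -natrD ler_pM2r ?invr_gt0 ?scaler_gt0 //.
by rewrite ler_nat pos_ge.
Qed.

Lemma right_inset s k : cell_right s.+1 k + inset s <= cell_right s (k %/ inner s).
Proof.
rewrite /cell_right !rat_of_fracc ?scale_gt0 // (frac_scale _ s) /inset -mulrDl -natrD.
rewrite ler_pM2r ?invr_gt0 ?scaler_gt0 // ler_nat.
by have := pos_le s k; rewrite !addn1.
Qed.

Lemma left_anc s i k : (i <= s)%N -> cell_left i (anc s i k) <= cell_left s k.
Proof.
move=> /subnK <-; elim: (s - i)%N k => [|n IHn] k; first by rewrite ancn.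
rewrite addSn ancS ?leq_addl //; apply: le_trans (IHn _) _.
by apply: le_trans (left_inset _ _); rewrite lerDl ltW ?inset_gt0.
Qed.

Lemma right_anc s i k : (i <= s)%N -> cell_right s k <= cell_right i (anc s i k).
Proof.
move=> /subnK <-; elim: (s - i)%N k => [|n IHn] k; first by rewrite ancn.
rewrite addSn ancS ?leq_addl //; apply: le_trans (IHn _).
by apply: le_trans (right_inset _ _); rewrite lerDl ltW ?inset_gt0.
Qed.

Lemma left_ge0 s k : 0 <= cell_left s k.
Proof. by rewrite cell_leftE divr_ge0. Qed.

Lemma right_le1 s k : cell_right s k <= 1.
Proof.
rewrite /cell_right rat_of_fracc ?scale_gt0 // ler_pdivrMr ?scaler_gt0 // mul1r ler_nat.
by rewrite -addn1 pos_scale.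
Qed.

Lemma cell_disjoint s k l : (k < nodes s)%N -> (l < nodes s)%N -> k != l ->
  cell_right s k <= cell_left s l \/ cell_right s l <= cell_left s k.
Proof.
move=> kn ln kl; rewrite /cell_right !cell_leftE !rat_of_fracc ?scale_gt0 //.
rewrite !ler_pM2r ?invr_gt0 ?scaler_gt0 // !ler_nat.
have : pos s k != pos s l by apply: contra kl => /eqP /(pos_inj _ _ _ kn ln) ->.
by rewrite neq_ltn => /orP.
Qed.

Lemma cell_lt i k l : (k %/ inner i = l %/ inner i)%N -> (k < l)%N ->
  if odd i then cell_right i.+1 l <= cell_left i.+1 k
  else cell_right i.+1 k <= cell_left i.+1 l.
Proof.
move=> kl h; have := pos_lt _ _ _ kl h.
rewrite /cell_right !cell_leftE !rat_of_fracc ?scale_gt0 //.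
by case: odd; rewrite !ler_pM2r ?invr_gt0 ?scaler_gt0 // !ler_nat.
Qed.

(** Test number [e] is read at its level [e.+3].  Only intervals that strictly
    contain the whole cell count.  This makes [hit] decidable, and every point
    of the test still lies in a covered cell once the cells are small enough. *)
Definition hit e s k := has (fun i => has (fun j =>
    [&& halts_by e (pr e.+3 (pr i j)) s, ltc i (cell_leftc s k)
      & ltc (cell_rightc s k) j])
  (iota 0 s)) (iota 0 s).

Lemma hitP e s k : reflect (exists i j, [/\ (i < s)%N, (j < s)%N,
    halts_by e (pr e.+3 (pr i j)) s, rat_of_code i < cell_left s k
    & cell_right s k < rat_of_code j]) (hit e s k).
Proof.
apply: (iffP hasP) => [[i] | [i [j [is_ js h1 h2 h3]]]].
  rewrite mem_iota => is_ /hasP[j]; rewrite mem_iota => js /and3P[h1].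
  by rewrite !rat_of_ltc => h2 h3; exists i, j.
exists i; rewrite ?mem_iota //; apply/hasP; exists j; rewrite ?mem_iota //.
by rewrite h1 !rat_of_ltc h2.
Qed.

Lemma hitS e s k : hit e s (k %/ inner s) -> hit e s.+1 k.
Proof.
move=> /hitP[i [j [is_ js h1 h2 h3]]]; apply/hitP; exists i, j; split.
- exact: ltnW.
- exact: ltnW.
- exact: halts_by_mono h1.
- apply: lt_le_trans h2 _; apply: le_trans (left_inset _ _).
  by rewrite lerDl ltW ?inset_gt0.
- apply: le_lt_trans _ h3; apply: le_trans (right_inset _ _).
  by rewrite lerDl ltW ?inset_gt0.
Qed.

Lemma computes_hit E S K : computes E -> computes S -> computes K ->
  computes (fun g x => hit (E g x) (S g x) (K g x)).
Proof. by move=> cE cS cK; rewrite /hit /cell_leftc /cell_rightc; comp. Qed.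

Definition cur s i := anc s i (least hit s).

Lemma computes_cur S I : computes S -> computes I ->
  computes (fun g x => cur (S g x) (I g x)).
Proof.
move=> cS cI; rewrite /cur; apply: computes_anc => //.
by apply: computes_least => //; exact: computes_hit.
Qed.

(** The tag [pr1 n] selects a natural number, the opposite of one, or an end
    of the cell [cur s i].  The integers make the points unbounded in both
    directions, which the envelopes need far away from [beta]; for [i > s] the
    value 0 is a harmless integer. *)
Definition pointc n :=
  let v := pr2 n in let s := pr1 v in let i := pr1 (pr2 v) in
  if pr1 n == 0%N then fracc v 1 else
  if pr1 n == 1%N then oppc (fracc v 1) else
  if ~~ (i <= s)%N then fracc 0 1 else
  if pr2 (pr2 v) == 0%N then cell_leftc i (cur s i) else cell_rightc i (cur s i).

Lemma computes_pointc F : computes F -> computes (fun g x => pointc (F g x)).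
Proof.
move=> cF; have := computes_cur; rewrite /pointc /cell_leftc /cell_rightc => cc.
by do 3! (apply: computes_if; comp).
Qed.

Definition point n := rat_of_code (pointc n).

Lemma point_nat n : exists m, point m = n%:R.
Proof.
by exists (pr 0 n); rewrite /point /pointc !(pr1_pr, pr2_pr) rat_of_fracc // divr1.
Qed.

Lemma point_opp n : exists m, point m = - n%:R.
Proof.
exists (pr 1 n); rewrite /point /pointc !(pr1_pr, pr2_pr) /=.
by rewrite rat_of_oppc rat_of_fracc // divr1.
Qed.

Lemma point_left s i : (i <= s)%N -> exists m, point m = cell_left i (cur s i).
Proof.
move=> is_; exists (pr 2 (pr s (pr i 0))).
by rewrite /point /pointc !(pr1_pr, pr2_pr) /= is_.
Qed.

Lemma point_right s i : (i <= s)%N -> exists m, point m = cell_right i (cur s i).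
Proof.
move=> is_; exists (pr 2 (pr s (pr i 1))).
by rewrite /point /pointc !(pr1_pr, pr2_pr) /= is_.
Qed.

Lemma point_cases n : (exists m : int, point n = m%:~R) \/
  exists s i, (i <= s)%N /\ (point n = cell_left i (cur s i) \/ point n = cell_right i (cur s i)).
Proof.
rewrite /point /pointc; case: eqP => _.
  by left; exists (pr2 n)%:Z; rewrite rat_of_fracc // divr1.
case: eqP => _.
  by left; exists (- (pr2 n)%:Z); rewrite rat_of_oppc rat_of_fracc // divr1 mulrNz.
case: leqP => h /=; last by left; exists 0; rewrite rat_of_fracc // mul0r.
by right; do 2 eexists; split; [exact: h | case: eqP => _; [left|right]].
Qed.

End Cells.

(** * One-sided limits and Cauchy names *)

Section Limsup.
Variable R : realType.
Implicit Types (F : set_system R) (g : R -> R) (P : R -> Prop).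

Definition frequently F P := forall V, F V -> exists2 x, V x & P x.

Lemma limf_esup_frequently F g (l : R) :
  F [set x | g x <= l] -> (forall e, 0 < e -> frequently F (fun x => l - e < g x)) ->
  limf_esup (EFin \o g) F = l%:E.
Proof.
move=> Fl Fg; apply/eqP; rewrite eq_le; apply/andP; split.
  apply: ge_ereal_inf; exists (ereal_sup ((EFin \o g) @` [set x | g x <= l])).
    by exists [set x | g x <= l].
  by apply: ge_ereal_sup => _ [x gx <-]; rewrite /= lee_fin.
apply: le_ereal_inf_tmp => _ [V FV <-].
apply/lee_addgt0Pr => e e0; have [x Vx gx] := Fg e e0 V FV.
rewrite -leeBlDr // -EFinB; apply: (@le_trans _ _ (g x)%:E); first by rewrite lee_fin ltW.
by apply: ereal_sup_ubound; exists x.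
Qed.

Lemma limf_einf_frequently F g (l : R) :
  F [set x | l <= g x] -> (forall e, 0 < e -> frequently F (fun x => g x < l + e)) ->
  limf_einf (EFin \o g) F = l%:E.
Proof.
move=> Fl Fg; rewrite /limf_einf.
rewrite (_ : (\- (EFin \o g))%E = EFin \o (fun x => - g x)) //.
rewrite (@limf_esup_frequently _ _ (- l)) /= ?EFinN ?oppeK //.
  by move: Fl; congr F; apply/seteqP; split=> x /=; rewrite lerN2.
move=> e e0 V FV; have [x Vx gx] := Fg e e0 V FV; exists x => //.
by rewrite -opprD ltrN2.
Qed.

Lemma limf_esup_pinfty F g :
  (forall M, frequently F (fun x => M < g x)) -> limf_esup (EFin \o g) F = +oo%E.
Proof.
move=> Fg; apply: eq_infty => M.
apply: le_ereal_inf_tmp => _ [V FV <-].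
have [x Vx gx] := Fg M V FV.
apply: (@le_trans _ _ (g x)%:E); first by rewrite lee_fin ltW.
by apply: ereal_sup_ubound; exists x.
Qed.

Lemma frequently_left b P :
  (forall e, 0 < e -> exists x, [/\ b - e < x, x < b & P x]) -> frequently b^'- P.
Proof.
move=> bP V [e /= e0 eV]; have [x [ex xb Px]] := bP e e0; exists x => //.
by apply: eV => //=; rewrite gtr0_norm; lra.
Qed.

Lemma frequently_right b P :
  (forall e, 0 < e -> exists x, [/\ b < x, x < b + e & P x]) -> frequently b^'+ P.
Proof.
move=> bP V [e /= e0 eV]; have [x [bx xe Px]] := bP e e0; exists x => //.
by apply: eV => //=; rewrite ltr0_norm; lra.
Qed.

Lemma cauchy_name_dist (q : nat -> rat) (x : R) n : cauchy_name q x ->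
  `|x - ratr (q n)| <= 2^-1 ^+ n.
Proof.
move=> [qx qc].
have h : (`|ratr (q m) - ratr (q n)| : R) @[m --> \oo] --> `|x - ratr (q n)|.
  by apply: cvg_norm; apply: cvgB => //; exact: cvg_cst.
apply: (cvgr_to_le h); near=> m.
have : `|q m - q n| <= 2^-1 ^+ n by apply: qc; near: m; exact: nbhs_infty_ge.
rewrite -(ler_rat R) rmorphXn fmorphV rmorph_nat /=.
by rewrite -raddfB /= -ratr_norm.
Unshelve. all: by end_near.
Qed.

Lemma exp2_small (e : R) : 0 < e -> exists n, 2^-1 ^+ n < e.
Proof.
move=> e0; have : ((2^-1 : R) ^+ n) @[n --> \oo] --> (0 : R).
  by apply: cvg_expr; rewrite ger0_norm ?invr_ge0 // invf_lt1 // ltr1n.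
move=> /cvgrPdist_lt /(_ e e0) [n _ /(_ n (leqnn n))] /=.
by rewrite sub0r normrN ger0_norm ?exprn_ge0 ?invr_ge0 //; exists n.
Qed.

End Limsup.

(** * Distance to a sequence and supremum of the terms below *)

Section Envelopes.
Variable R : realType.
Variable a : nat -> rat.
Implicit Types (x y : R).

Let ra n : R := ratr (a n).

Definition below x := sup [set y | exists2 n, ra n < x & y = ra n].
Definition dist x := inf [set y | exists n, y = `|x - ra n|].

(* Explicit bounds on the nearest terms provide the values that the
   semicomputations output before they have found a term below [x]. *)
Hypothesis dense2 : forall x, exists n, x - 2 <= ra n < x.

Lemma below_has_sup x : has_sup [set y | exists2 n, ra n < x & y = ra n].
Proof.
split; first by have [n /andP[_ nx]] := dense2 x; exists (ra n); exists n.
by exists x => _ [n nx ->]; exact: ltW.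
Qed.

Lemma le_below n x : ra n < x -> ra n <= below x.
Proof. by move=> nx; apply: ub_le_sup; [case: (below_has_sup x) | exists n]. Qed.

Lemma below_le x c : (forall n, ra n < x -> ra n <= c) -> below x <= c.
Proof.
move=> h; apply: ge_sup; first by case: (below_has_sup x).
by move=> _ [n nx ->]; exact: h.
Qed.

Lemma below_le_id x : below x <= x.
Proof. by apply: below_le => n /ltW. Qed.

Lemma below_nondecreasing : nondecreasing_fun below.
Proof.
move=> x y xy; apply: below_le => n nx.
exact/le_below/(lt_le_trans nx).
Qed.

Lemma below_adherent x e : 0 < e -> exists n, ra n < x /\ below x - e < ra n.
Proof.
move=> e0; have [_ [n nx ->] h] := sup_adherent e0 (below_has_sup x).
by exists n.
Qed.

Lemma dist_has_inf x : has_inf [set y | exists n, y = `|x - ra n|].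
Proof. by split; [exists `|x - ra 0|; exists 0%N | exists 0 => _ [n ->]]. Qed.

Lemma dist_le n x : dist x <= `|x - ra n|.
Proof. by apply: ge_inf; [case: (dist_has_inf x) | exists n]. Qed.

Lemma le_dist x c : (forall n, c <= `|x - ra n|) -> c <= dist x.
Proof.
move=> h; apply: lb_le_inf; first by case: (dist_has_inf x).
by move=> _ [n ->].
Qed.

Lemma dist_ge0 x : 0 <= dist x. Proof. exact: le_dist. Qed.

Lemma dist_adherent x e : 0 < e -> exists n, `|x - ra n| < dist x + e.
Proof.
by move=> e0; have [_ [n ->] h] := inf_adherent e0 (dist_has_inf x); exists n.
Qed.

Lemma dist_lip x y : dist x <= dist y + `|x - y|.
Proof.
rewrite -lerBlDr; apply: le_dist => n; rewrite lerBlDr.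
apply: le_trans (dist_le n x) _; rewrite [leRHS]addrC.
exact: ler_distD.
Qed.

Lemma dist_lipschitz : 1.-lipschitz dist.
Proof.
move=> [x y] _ /=; rewrite mul1r ler_norml; apply/andP; split.
  by have := dist_lip y x; rewrite distrC; lra.
by have := dist_lip x y; lra.
Qed.

Variable c : nat -> nat.
Hypothesis computes_c : forall F, computes F -> computes (fun g n => c (F g n)).
Hypothesis cE : forall n, rat_of_code (c n) = a n.
Hint Resolve computes_c : comp.

Lemma ratr_half n : ratr (2^-1 ^+ n) = 2^-1 ^+ n :> R.
Proof. by rewrite rmorphXn fmorphV rmorph_nat. Qed.

Lemma rat_of_half n : rat_of_code (fracc 1 (2 ^ n)) = 2^-1 ^+ n.
Proof. by rewrite rat_of_fracc ?expn_gt0 // natrX mul1r exprVn. Qed.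

(** [- dist x] is the supremum over [n] and [m] of
    [- (|q m - a n| + 2^-m)], where [q] is the name of [x]. *)
Lemma dist_semicomputable : lower_semicomputable (fun x => - dist x).
Proof.
pose P (g : nat -> nat) k := oppc (addc
  (absc (addc (g (pr2 k)) (oppc (c (pr1 k))))) (fracc 1 (2 ^ pr2 k)%N)).
have cP : computes P by rewrite /P; comp.
apply: (lower_semicomputable_sup R _ P cP) => x q g qx gq.
have PE n m : ratr (rat_of_code (P g (pr n m))) =
    - (`|ratr (q m) - ra n| + 2^-1 ^+ m) :> R.
  rewrite /P !(pr1_pr, pr2_pr, rat_of_oppc, rat_of_addc, rat_of_absc) rat_of_half.
  by rewrite gq cE raddfN raddfD /= ratr_norm raddfB /= ratr_half.
split=> [k|e e0].
  rewrite -(pr_eta k) PE lerN2; apply: le_trans (dist_le (pr1 k) x) _.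
  set m := pr2 k; have := cauchy_name_dist R q x m qx.
  by have := ler_distD (ratr (q m)) x (ra (pr1 k)); lra.
have e2 : 0 < e / 3 by lra.
have [n nx] := dist_adherent x _ e2; have [m me] := exp2_small _ _ e2.
exists (pr n m); rewrite PE.
have := cauchy_name_dist R q x m qx.
by have := ler_distD x (ratr (q m)) (ra n); rewrite (distrC (ratr _) x); lra.
Qed.

(** The inequality [a n < x] is certified at precision 2^-m; without a
    certificate the output is [q 0 - 3], which is at most [x - 2] and so lies
    below some term that is smaller than [x].  The flag [b] reads the name of
    [x] as one of [- x], which serves for the infimum of the terms above. *)
Lemma below_semicomputable (b : bool) :
  lower_semicomputable (fun x => below (if b then - x else x)).
Proof.
pose sc v := if b then oppc v else v.
have csc F : computes F -> computes (fun g n => sc (F g n)).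
  by move=> cF; rewrite /sc; case: (b); comp.
pose P (g : nat -> nat) k :=
  if ltc (c (pr1 k)) (addc (sc (g (pr2 k))) (oppc (fracc 1 (2 ^ pr2 k)%N)))
  then c (pr1 k) else addc (sc (g 0)) (oppc (fracc 3 1)).
have cP : computes P by rewrite /P; comp.
apply: (lower_semicomputable_sup R _ P cP) => x q g qx gq.
set y := if b then - x else x.
pose p m : rat := if b then - q m else q m.
have scE m : rat_of_code (sc (g m)) = p m.
  by rewrite /sc /p; case: (b); rewrite ?rat_of_oppc gq.
have py m : `|y - ratr (p m)| <= 2^-1 ^+ m.
  have := cauchy_name_dist R q x m qx; rewrite /y /p; case: (b) => //.
  by rewrite raddfN -opprD normrN.
have PE n m : ratr (rat_of_code (P g (pr n m))) =
    if ra n < ratr (p m) - 2^-1 ^+ m then ra n else ratr (p 0) - 3 :> R.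
  rewrite /P !(pr1_pr, pr2_pr) rat_of_ltc rat_of_addc scE rat_of_oppc rat_of_half.
  rewrite -(ltr_rat R) raddfB /= ratr_half cE -/(ra n); case: ifP => _.
    by rewrite cE.
  by rewrite rat_of_addc scE rat_of_oppc rat_of_fracc // divr1 raddfB /= rmorph_nat.
split=> [k|e e0].
  rewrite -(pr_eta k) PE; case: ifP => h.
    apply: le_below; apply: lt_le_trans h _.
    by have := py (pr2 k); rewrite ler_norml => /andP[]; lra.
  have [n /andP[yn ny]] := dense2 y; apply: le_trans _ (le_below _ _ ny).
  by have := py 0%N; rewrite ler_norml expr0 => /andP[]; lra.
have [n [ny ne]] := below_adherent y e e0.
have e2 : 0 < (y - ra n) / 2 by lra.
have [m me] := exp2_small _ _ e2.
exists (pr n m); rewrite PE.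
by have := py m; rewrite ler_norml => /andP[h1 h2]; rewrite ifT //; lra.
Qed.

End Envelopes.

(** * Difference quotients at a limit point with gaps *)

Section LeftBehaviour.
Variable R : realType.
Variables (a : nat -> rat) (beta : R).
Let ra n : R := ratr (a n).
Notation dist := (dist R a).
Notation below := (below R a).

Definition left_limit_point := forall e, 0 < e -> exists n, beta - e < ra n < beta.
(** The gap runs from [u] to [v], to the left of [beta], and [u] is more than [M]
    times as far from [beta] as [v]. *)
Definition left_gaps := forall e M, 0 < e -> exists u v,
  [/\ beta - e < u, u < v, v < beta, M * (beta - v) < beta - u
    & forall n, ra n <= u \/ v <= ra n].
Hypothesis acc : left_limit_point.
Hypothesis gaps : left_gaps.

Lemma dist_limit_point : dist beta = 0.
Proof.
apply/eqP; rewrite eq_le dist_ge0 andbT; apply/ler_addgt0Pr => e e0.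
have [n /andP[h1 h2]] := acc e e0; apply: le_trans (dist_le R a n beta) _.
by rewrite ger0_norm -/(ra n); lra.
Qed.

Lemma below_limit_point : (forall x, exists n, x - 2 <= ra n < x) ->
  below beta = beta.
Proof.
move=> dense; apply/eqP; rewrite eq_le below_le_id //=.
apply/ler_addgt0Pr => e e0; have [n /andP[h1 h2]] := acc e e0.
by have := le_below R a dense n beta h2; rewrite -/(ra n); lra.
Qed.

Lemma dist_quotient_le1 x : `|diff_quotient dist beta x| <= 1.
Proof.
have [->|xb] := eqVneq x beta; first by rewrite /diff_quotient subrr mul0r normr0.
rewrite normrM normfV ler_pdivrMr ?normr_gt0 ?subr_eq0 1?eq_sym // mul1r.
have := dist_lip R a beta x; have := dist_lip R a x beta.
by rewrite ler_norml (distrC x beta); lra.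
Qed.

Lemma dist_quotient_small e : 0 < e -> exists x,
  [/\ beta - e < x, x < beta & `|diff_quotient dist beta x| = 0].
Proof.
move=> e0; have [n /andP[h1 h2]] := acc e e0; exists (ra n); split=> //.
rewrite /diff_quotient dist_limit_point (_ : dist (ra n) = 0) ?subrr ?mul0r ?normr0 //.
apply/eqP; rewrite eq_le dist_ge0 andbT.
by have := dist_le R a n (ra n); rewrite subrr normr0.
Qed.

(** Halfway between [beta] and the far end [u] of a gap of ratio 2/d. *)
Lemma dist_quotient_large d e : 0 < d -> 0 < e -> exists x,
  [/\ beta - e < x, x < beta & 1 - d < `|diff_quotient dist beta x|].
Proof.
move=> d0 e0; have [u [v [eu uv vb Mv un]]] := gaps e (2 / d) e0.
exists ((beta + u) / 2); split; [lra|lra|].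
have hd : (beta - u) / 2 - (beta - v) <= dist ((beta + u) / 2).
  apply: le_dist => n; rewrite -/(ra n); have [nu|nv] := un n.
    by apply: le_trans (ler_norm _); lra.
  by rewrite distrC; apply: le_trans (ler_norm _); lra.
rewrite normrM normfV (gtr0_norm (_ : 0 < beta - (beta + u) / 2)); last by lra.
rewrite ltr_pdivlMr; last by lra.
rewrite dist_limit_point sub0r normrN ger0_norm ?dist_ge0 //.
move: Mv; rewrite mulrAC ltr_pdivrMr // => Mv.
by apply: lt_le_trans hd; nra.
Qed.

(** At the near end [v] of a gap, the terms below [v] are at most [u]. *)
Lemma below_quotient_large M e : (forall x, exists n, x - 2 <= ra n < x) ->
  0 < e -> exists x,
  [/\ beta - e < x, x < beta & M < `|diff_quotient below beta x|].
Proof.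
move=> dense e0; have [u [v [eu uv vb Mv un]]] := gaps e M e0.
exists v; split; [lra|lra|].
have bv : below v <= u.
  by apply: below_le => // n; have [//|nv] := un n; rewrite -/(ra n) ltNge nv.
rewrite /diff_quotient below_limit_point // normrM normfV.
rewrite (gtr0_norm (_ : 0 < beta - v)); last by lra.
rewrite ltr_pdivlMr; last by lra.
by rewrite ger0_norm; lra.
Qed.

End LeftBehaviour.

(** The right side of [beta] is the left side of [- beta] for the opposite
    sequence; in particular the infimum of the terms above [x] is the opposite
    of a supremum of terms below [- x]. *)
Section Envelope.
Variable R : realType.
Variables (a : nat -> rat) (beta : R) (c : nat -> nat).
Hypothesis computes_c : forall F, computes F -> computes (fun g n => c (F g n)).
Hypothesis cE : forall n, rat_of_code (c n) = a n.

Let ra n : R := ratr (a n).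
Let na n := - a n.

Hypothesis dense_left : forall x : R, exists n, x - 2 <= ra n < x.
Hypothesis dense_right : forall x : R, exists n, x < ra n <= x + 2.
Hypothesis accl : left_limit_point R a beta.
Hypothesis accr : left_limit_point R na (- beta).
Hypothesis gapl : left_gaps R a beta.
Hypothesis gapr : left_gaps R na (- beta).

Lemma distN (x : R) : dist R na x = dist R a (- x).
Proof.
rewrite /dist; congr inf; apply/seteqP; split=> _ [n ->]; exists n;
  by rewrite /na raddfN opprK /= -normrN opprD ?opprK.
Qed.

Definition above (x : R) := - below R na (- x).

Lemma dense_opp (x : R) : exists n, x - 2 <= ratr (na n) < x.
Proof.
have [n /andP[h1 h2]] := dense_right (- x); exists n.
by rewrite /na raddfN /= -/(ra n); lra.
Qed.

Lemma diff_quotientN (f : R -> R) (x : R) :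
  `|diff_quotient (fun y => f (- y)) (- beta) x| = `|diff_quotient f beta (- x)|.
Proof.
rewrite /diff_quotient opprK !normrM !normfV -(normrN (- beta - x)).
by rewrite opprD opprK.
Qed.

Lemma above_quotient (x : R) :
  `|diff_quotient above beta (- x)| = `|diff_quotient (below R na) (- beta) x|.
Proof.
rewrite -diff_quotientN /diff_quotient /above.
by rewrite (opprK (- beta)) (opprK x) -opprD mulNr normrN.
Qed.

Lemma dist_quotientN (x : R) :
  `|diff_quotient (dist R a) beta (- x)| = `|diff_quotient (dist R na) (- beta) x|.
Proof. by rewrite -diff_quotientN; congr (`| diff_quotient _ _ _ |); apply/funext => y; rewrite distN. Qed.

Lemma envelope_interval :
  exists h ft ht : R -> R,
    translation_function_interval (fun x => - h x) h beta 0 /\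
    translation_function_interval ft ht beta beta /\
    (exists L : R, L.-lipschitz h) /\
    nondecreasing_fun ft /\ nondecreasing_fun ht /\
    liminf_left (fun x => `|diff_quotient h beta x|) beta = 0%:E /\
    liminf_right (fun x => `|diff_quotient h beta x|) beta = 0%:E /\
    limsup_left (fun x => `|diff_quotient h beta x|) beta = 1%:E /\
    limsup_right (fun x => `|diff_quotient h beta x|) beta = 1%:E /\
    limsup_left (fun x => `|diff_quotient ft beta x|) beta = +oo%E /\
    limsup_right (fun x => `|diff_quotient ht beta x|) beta = +oo%E.
Proof.
have d0 := dist_limit_point R a beta accl.
have cN F : computes F -> computes (fun g n => oppc (c (F g n))).
  by move=> cF; have := computes_c _ cF; comp.
have cNE n : rat_of_code (oppc (c n)) = na n by rewrite rat_of_oppc cE.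
exists (dist R a), (below R a), above; do !split.
- by move=> x; rewrite -subr_ge0 opprK addr_ge0 ?dist_ge0.
- exact: dist_semicomputable computes_c cE.
- exact: dist_semicomputable computes_c cE.
- by rewrite d0 oppr0.
- exact: d0.
- move=> x; apply: le_trans (below_le_id R a dense_left x) _.
  by rewrite lerNr; exact: (below_le_id R na dense_opp).
- exact: (below_semicomputable R a dense_left c computes_c cE false).
- have := below_semicomputable R na dense_opp (fun n => oppc (c n)) cN cNE true.
  rewrite /upper_semicomputable; congr lower_semicomputable.
  by apply/funext => x; rewrite /above opprK.
- exact: below_limit_point.
- by rewrite /above (below_limit_point R na) ?opprK //; exact: dense_opp.
- by exists 1; exact: dist_lipschitz.
- exact: below_nondecreasing.
- move=> x y xy; rewrite /above lerN2.
  by apply: below_nondecreasing; [exact: dense_opp | rewrite lerN2].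
- apply: limf_einf_frequently => [|d dp]; first by apply: nearW => x _ /=; exact: normr_ge0.
  apply: frequently_left => e e0.
  have [x [ex xb q0]] := dist_quotient_small R a beta accl e e0.
  by exists x; split=> //; rewrite q0 add0r.
- apply: limf_einf_frequently => [|d dp]; first by apply: nearW => x _ /=; exact: normr_ge0.
  apply: frequently_right => e e0.
  have [x [ex xb q0]] := dist_quotient_small R na (- beta) accr e e0.
  by exists (- x); split; [lra|lra|]; rewrite dist_quotientN q0 add0r.
- apply: limf_esup_frequently => [|d dp].
    by apply: nearW => x _; exact: dist_quotient_le1.
  apply: frequently_left => e e0.
  exact: (dist_quotient_large R a beta accl gapl d e dp e0).
- apply: limf_esup_frequently => [|d dp].
    by apply: nearW => x _; exact: dist_quotient_le1.
  apply: frequently_right => e e0.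
  have [x [ex xb q]] := dist_quotient_large R na (- beta) accr gapr d e dp e0.
  by exists (- x); split; [lra|lra|]; rewrite dist_quotientN.
- apply: limf_esup_pinfty => M; apply: frequently_left => e e0.
  exact: (below_quotient_large R a beta accl gapl M e dense_left e0).
- apply: limf_esup_pinfty => M; apply: frequently_right => e e0.
  have [x [ex xb q]] :=
    below_quotient_large R na (- beta) accr gapr M e dense_opp e0.
  by exists (- x); split; [lra|lra|]; rewrite above_quotient.
Qed.

End Envelope.

(** * The limit point of the branch *)

Section Branch.
Variable b : nat -> nat.
Hypothesis bP : limit_branch hit b.

Let l i := cell_left i (b i).
Let r i := cell_right i (b i).

Lemma point_int (m : int) : exists n, point n = m%:~R.
Proof.
case: m => m; first exact: point_nat.
by have [n nm] := point_opp m.+1; exists n; rewrite nm NegzE mulrNz.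
Qed.

Lemma l_inset i : l i + inset i <= l i.+1.
Proof. by rewrite /l; have [_ <- _ _ _] := bP i; exact: left_inset. Qed.

Lemma r_inset i : r i.+1 + inset i <= r i.
Proof. by rewrite /r; have [_ <- _ _ _] := bP i; exact: right_inset. Qed.

Lemma l_lt i : l i < l i.+1.
Proof. by apply: lt_le_trans (l_inset i); rewrite ltrDl inset_gt0. Qed.

Lemma r_lt i : r i.+1 < r i.
Proof. by apply: lt_le_trans (r_inset i); rewrite ltrDl inset_gt0. Qed.

Lemma l_le i j : (i <= j)%N -> l i <= l j.
Proof.
move=> /subnK <-; elim: (j - i)%N => // n IHn; apply: le_trans IHn _.
by rewrite addSn ltW ?l_lt.
Qed.

Lemma r_le i j : (i <= j)%N -> r j <= r i.
Proof.
move=> /subnK <-; elim: (j - i)%N => // n IHn; apply: le_trans IHn.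
by rewrite addSn ltW ?r_lt.
Qed.

Lemma l_le_r i j : l i <= r j.
Proof.
apply: le_trans (l_le _ _ (leq_maxl i j)) _.
by apply: le_trans (r_le _ _ (leq_maxr i j)); exact/ltW/left_lt_right.
Qed.

(** A wrong guess separates from the branch at some level [m], where it is a
    sibling that comes earlier in the numbering. *)
Lemma cur_branch s j : (j <= s)%N -> cur s j = b j \/ exists m k,
  [/\ (m < j)%N, anc j m.+1 (cur s j) = k, (k %/ inner m)%N = b m & (k < b m.+1)%N].
Proof.
move=> js; have [|ne] := eqVneq (cur s j) (b j); [by left|right].
have ex : exists j', (j' <= j)%N && (cur s j' != b j') by exists j; rewrite leqnn.
case: (ex_minnP ex) => -[/andP[_]|m /andP[mj mne] mmin].
  have [b0 _ _ _ _] := bP 0; have := anc_lt s 0 (least hit s) isT.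
  have [lt _] := least_spec hit hitS s => /(_ lt); rewrite -/(cur s 0).
  by move: b0 => /=; rewrite !ltnS !leqn0 => /eqP -> /eqP ->; rewrite eqxx.
exists m, (cur s m.+1); split=> //.
- by rewrite /cur anc_anc // mj.
- rewrite /cur anc_div; last exact: leq_trans mj js.
  apply/eqP; apply: contraT => h; have := mmin m.
  by rewrite (ltnW mj) h ltnn => /(_ isT).
- have [_ _ _ /(_ s) h _] := bP m.+1.
  by rewrite ltn_neqAle mne h // (leq_trans mj js).
Qed.

(** The last case is that of an end of a wrong cell that left the branch at
    level [m]: the orientation of that level decides on which side of the true
    child it lies. *)
Lemma point_location n :
  [\/ exists m : int, point n = m%:~R, exists j, point n = l j,
      exists j, point n = r j
    | exists m, [/\ l m <= point n, point n <= r m &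
        if odd m then r m.+1 <= point n else point n <= l m.+1]].
Proof.
case: (point_cases n) => [[m h]|[s [j [js h]]]]; first by constructor 1; exists m.
have [e|[m [k [mj jk km kb]]]] := cur_branch s j js.
  move: h; rewrite e => -[h|h]; first by constructor 2; exists j.
  by constructor 3; exists j.
constructor 4; exists m.
have [_ bm _ _ _] := bP m.
have h1 := left_anc j m.+1 (cur s j) mj; have h2 := right_anc j m.+1 (cur s j) mj.
have h3 : cell_left j (cur s j) <= point n.
  by case: h => ->; rewrite ?lexx // ltW ?left_lt_right.
have h4 : point n <= cell_right j (cur s j).
  by case: h => ->; rewrite ?lexx // ltW ?left_lt_right.
rewrite jk in h1 h2; have {}h1 := le_trans h1 h3; have {}h2 := le_trans h4 h2.
have g0 := inset_gt0 m.
split.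
- by rewrite /l -km; have := left_inset m k; lra.
- by rewrite /r -km; have := right_inset m k; lra.
- have := cell_lt m k (b m.+1); rewrite km bm => /(_ erefl kb).
  by rewrite /l /r; case: odd => h5; [apply: le_trans h1 | apply: le_trans h5].
Qed.

Lemma point_int_location i n (m : int) : point n = m%:~R ->
  point n <= l i \/ r i <= point n.
Proof.
move=> ->; have := left_ge0 i (b i); have := right_le1 i (b i).
rewrite -/(l i) -/(r i); have [m0|m0] := leP m 0.
  have : (m%:~R : rat) <= 0 by rewrite lerz0.
  by left; lra.
have : (1 : rat) <= m%:~R by rewrite ler1z.
by right; lra.
Qed.

(** Inside the cell of level [i] of the branch, a point either lies in the child
    on the branch or comes from a cell that left the branch at level [i]; as
    [i] is odd, such cells are to the right of that child. *)
Lemma no_point_left i n : odd i -> point n <= l i \/ l i.+1 <= point n.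
Proof.
move=> oi; case: (point_location n) => [[m]|[j ->]|[j ->]|[m [h1 h2 h3]]].
- move=> /point_int_location => /(_ i) [|h]; [by left|right].
  exact: le_trans (l_le_r _ _) h.
- by have [ji|ij] := leqP j i; [left|right]; exact: l_le.
- by right; exact: l_le_r.
- case: ifP h3 => om h3; first by right; apply: le_trans h3; exact: l_le_r.
  have [mi|im|mi] := ltngtP m i; last by rewrite mi oi in om.
    by left; apply: le_trans h3 _; exact: l_le.
  by right; apply: le_trans h1; exact: l_le.
Qed.

(** The mirror image of [no_point_left]. *)
Lemma no_point_right i n : ~~ odd i -> point n <= r i.+1 \/ r i <= point n.
Proof.
move=> oi; case: (point_location n) => [[m]|[j ->]|[j ->]|[m [h1 h2 h3]]].
- move=> /point_int_location => /(_ i) [h|]; [left|by right].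
  exact: le_trans h (l_le_r _ _).
- by left; exact: l_le_r.
- by have [ji|ij] := leqP j i; [right|left]; exact: r_le.
- case: ifP h3 => om h3; last by left; apply: le_trans h3 _; exact: l_le_r.
  have [mi|im|mi] := ltngtP m i; last by rewrite -mi om in oi.
    by right; apply: le_trans h3; exact: r_le.
  by left; apply: le_trans h2 _; exact: r_le.
Qed.

Variable R : realType.
Definition branch_point : R := sup (range (fun i => ratr (l i))).
Local Notation beta := branch_point.

Lemma branch_point_ge i : ratr (l i) <= beta.
Proof.
apply: ub_le_sup; last by exists i.
by exists (ratr (r 0)) => _ [j _ <-]; rewrite ler_rat l_le_r.
Qed.

Lemma branch_point_le i : beta <= ratr (r i).
Proof.
apply: ge_sup; first by exists (ratr (l 0)); exists 0%N.
by move=> _ [j _ <-]; rewrite ler_rat l_le_r.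
Qed.

Lemma branch_point_gt i : ratr (l i) < beta.
Proof. by apply: lt_le_trans (branch_point_ge i.+1); rewrite ltr_rat l_lt. Qed.

Lemma branch_point_lt i : beta < ratr (r i).
Proof. by apply: le_lt_trans (branch_point_le i.+1) _; rewrite ltr_rat r_lt. Qed.

Definition width i : R := (scale i)%:R^-1.

Lemma widthE i : ratr (r i) = ratr (l i) + width i.
Proof. by rewrite /r cell_rightE raddfD /= fmorphV rmorph_nat. Qed.

Lemma width_small e : 0 < e -> exists i0, forall i, (i0 <= i)%N -> width i < e.
Proof.
move=> e0; exists (Num.truncn e^-1).+1 => i hi.
rewrite /width invf_plt ?posrE ?ltr0n ?scale_gt0 //.
apply: lt_le_trans (truncnS_gt _) _; rewrite ler_nat.
exact: leq_trans hi (scale_gt i).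
Qed.

Lemma branch_point_approximable : computably_approximable beta.
Proof.
exists (fun s => cell_left s (least hit s)).
  have [c cE] : computes (fun _ s => cell_leftc s (least hit s)).
    have := computes_least hit computes_hit _ computes_id.
    by rewrite /cell_leftc => cl; comp.
  by exists c => s; exists (cell_leftc s (least hit s)); first exact: cE.
apply/cvgrPdist_lt => e e0; have [i0 iP] := width_small e e0.
have [_ _ _ _ [s0 is0 sP]] := bP i0.
near=> s; have ss : (s0 <= s)%N by near: s; exact: nbhs_infty_ge.
have is_ : (i0 <= s)%N := leq_trans is0 ss.
have h1 := left_anc s i0 (least hit s) is_; have h2 := right_anc s i0 (least hit s) is_.
rewrite (sP _ ss) -/(l i0) -/(r i0) in h1 h2.
have h3 := left_lt_right s (least hit s).
have {h2}h3 : cell_left s (least hit s) <= r i0 by lra.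
rewrite -(ler_rat R) in h1; rewrite -(ler_rat R) in h3.
have := branch_point_ge i0; have := branch_point_le i0; have := iP i0 (leqnn _).
have := widthE i0; rewrite ltr_norml; move: h1 h3.
set x := ratr (cell_left s _); set y := ratr (l i0); set z := ratr (r i0).
by lra.
Unshelve. all: by end_near.
Qed.

Lemma branch_point_left_limit : left_limit_point R point beta.
Proof.
move=> e e0; have [i iP] := width_small e e0; have [_ _ _ _ [s is_ sP]] := bP i.
have [n nE] := point_left s i is_; exists n; rewrite nE /cur sP // -/(l i).
have := branch_point_gt i; have := branch_point_lt i.
by have := iP i (leqnn i); rewrite widthE; lra.
Qed.

Lemma branch_point_right_limit : left_limit_point R (fun n => - point n) (- beta).
Proof.
move=> e e0; have [i iP] := width_small e e0; have [_ _ _ _ [s is_ sP]] := bP i.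
have [n nE] := point_right s i is_; exists n; rewrite nE /cur sP // -/(r i).
have := branch_point_gt i; have := branch_point_lt i.
by have := iP i (leqnn i); rewrite raddfN /= widthE; lra.
Qed.

Lemma inset_width M e : 0 < e -> exists i0, forall i, (i0 <= i)%N ->
  width i < e /\ M * width i.+1 <= ratr (inset i).
Proof.
move=> e0; have [i0 iP] := width_small e e0.
exists (maxn i0 (Num.truncn M).+1) => i; rewrite geq_max => /andP[ii Mi].
split; first exact: iP.
rewrite /inset rmorphM fmorphV !rmorph_nat ler_pM2r ?invr_gt0 ?ltr0n ?scale_gt0 //.
apply: le_trans (ltW (truncnS_gt _)) _; rewrite ler_nat; apply: leq_trans Mi _.
exact/ltnW/ltn_expl.
Qed.

(** The gap lies between the left ends of two successive cells of the branch: its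
    length is at least [margin i] widths of the smaller cell, which contains
    [beta]. *)
Lemma branch_point_left_gaps : left_gaps R point beta.
Proof.
move=> e M e0.
(* A negative [M] is replaced by 0 to make multiplication by it monotone. *)
have [i0 iP] := inset_width (Num.max M 0) e e0.
set i := i0.*2.+1; have [|we Mw] := iP i; first by rewrite /i; lia.
have oi : odd i by rewrite /i /= odd_double.
exists (ratr (l i)), (ratr (l i.+1)).
have h1 := branch_point_gt i; have h2 := branch_point_lt i.
have h3 := branch_point_gt i.+1; have h4 := branch_point_lt i.+1.
rewrite !widthE in h2 h4.
have M0 : 0 <= Num.max M 0 by rewrite le_max lexx orbT.
have MM : M <= Num.max M 0 by rewrite le_max lexx.
have lg : ratr (l i) + ratr (inset i) <= ratr (l i.+1) :> R.
  by rewrite -raddfD ler_rat l_inset.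
split=> //.
- by lra.
- by rewrite ltr_rat l_lt.
- move: (Num.max M 0) (width i.+1) Mw M0 MM h4 => K w Mw M0 MM h4.
  have : M * (beta - ratr (l i.+1)) <= K * (beta - ratr (l i.+1)).
    by apply: ler_wpM2r => //; lra.
  have : K * (beta - ratr (l i.+1)) <= K * w by apply: ler_wpM2l => //; lra.
  by lra.
- by move=> n; rewrite !ler_rat; exact: no_point_left.
Qed.

Lemma branch_point_right_gaps : left_gaps R (fun n => - point n) (- beta).
Proof.
move=> e M e0; have [i0 iP] := inset_width (Num.max M 0) e e0.
set i := i0.*2; have [|we Mw] := iP i; first by rewrite /i; lia.
have oi : ~~ odd i by rewrite /i /= odd_double.
exists (- ratr (r i)), (- ratr (r i.+1)).
have h1 := branch_point_gt i; have h2 := branch_point_lt i.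
have h3 := branch_point_gt i.+1; have h4 := branch_point_lt i.+1.
have M0 : 0 <= Num.max M 0 by rewrite le_max lexx orbT.
have MM : M <= Num.max M 0 by rewrite le_max lexx.
have rg : ratr (r i.+1) + ratr (inset i) <= ratr (r i) :> R.
  by rewrite -raddfD ler_rat r_inset.
split=> //.
- by have := widthE i; lra.
- by rewrite ltrN2 ltr_rat r_lt.
- by rewrite ltrN2.
- have := widthE i.+1.
  move: (Num.max M 0) (width i.+1) Mw M0 MM => K w Mw M0 MM wE.
  have : M * (ratr (r i.+1) - beta) <= K * (ratr (r i.+1) - beta).
    by apply: ler_wpM2r => //; lra.
  have : K * (ratr (r i.+1) - beta) <= K * w by apply: ler_wpM2l => //; lra.
  by lra.
- move=> n; rewrite raddfN /= !lerN2 !ler_rat.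
  by have [|] := no_point_right i n oi; [right|left].
Qed.

End Branch.

(** * Randomness *)

Section Random.
Variable R : realType.

Lemma ce_open_measurable c n : measurable (ce_open (R := R) c n).
Proof.
apply: measurable_realfun.open_measurable.
pose D := [set ij : nat * nat | exists y, eval0 c (pr n (pr ij.1 ij.2)) y].
pose J (ij : nat * nat) : set R :=
  `]ratr (rat_of_code ij.1), ratr (rat_of_code ij.2)[%classic.
rewrite (_ : ce_open (R := R) c n = \bigcup_(ij in D) J ij).
  by apply: bigcup_open => ij _; exact: interval_open.
apply/seteqP; split=> x /=.
  by move=> [i [j [yP xij]]]; exists (i, j) => //; rewrite /J /= in_itv.
by move=> [[i j] yP]; rewrite /J /= in_itv /= => xij; exists i, j.
Qed.

Definition cell s k : set R := `]ratr (cell_left s k), ratr (cell_right s k)[%classic.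

Lemma cell_measure s k : lebesgue_measure (cell s k) = (width R s)%:E.
Proof.
rewrite lebesgue_measure_itv /= lte_fin ltr_rat left_lt_right -EFinB cell_rightE.
by rewrite rmorphD /= fmorphV rmorph_nat addrC addKr.
Qed.

Lemma trivIset_cell s (D : set nat) :
  (forall k, D k -> (k < nodes s)%N) -> trivIset D (cell s).
Proof.
move=> Dn k l /Dn kn /Dn ln [x []]; rewrite /cell /= !in_itv /= => /andP[h1 h2] /andP[h3 h4].
apply/eqP; apply: contraT => /(cell_disjoint _ _ _ kn ln)[]; rewrite -(ler_rat R).
  by move=> h; have := lt_trans h3 (lt_le_trans h2 h); rewrite ltxx.
by move=> h; have := lt_trans h1 (lt_le_trans h4 h); rewrite ltxx.
Qed.

(** The cells hit at level [s] are disjoint intervals inside the open set, so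
    their number is at most [scale s * 2^-(e+3)], and [scale s] is at most twice
    [nodes s]. *)
Lemma active_measure c s :
  (lebesgue_measure (ce_open (R := R) c (code_num c).+3) <= (2^-1 ^+ (code_num c).+3)%:E)%E ->
  active hit (code_num c) s.
Proof.
set e := code_num c => Lle.
pose ks := [seq k <- iota 0 (nodes s) | hit e s k].
have ksn k : k \in ks -> (k < nodes s)%N.
  by rewrite mem_filter mem_iota => /andP[].
have sub : \bigcup_(k in [set` ks]) cell s k `<=` ce_open (R := R) c e.+3.
  move=> x [k /=]; rewrite mem_filter => /andP[/hitP[i [j [_ _ ht h1 h2]]] _].
  rewrite /cell /= in_itv /= => /andP[h3 h4]; exists i, j; split.
    by apply/halts_byP; exists s.
  rewrite -(ltr_rat R) in h1; rewrite -(ltr_rat R) in h2.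
  by rewrite (lt_trans h1 h3) (lt_trans h4 h2).
have mcell k : measurable (cell s k) by exact: measurable_itv.
have : (lebesgue_measure (\bigcup_(k in [set` ks]) cell s k) <=
        (2^-1 ^+ e.+3)%:E)%E.
  apply: le_trans Lle; apply: le_measure => //; rewrite inE.
    by apply: fin_bigcup_measurable => [|k _]; [exact: finite_seq | exact: mcell].
  exact: ce_open_measurable.
rewrite measure_fin_bigcup //=; [|exact: trivIset_cell|by move=> k _; exact: mcell].
rewrite -fsbig_seq ?filter_uniq ?iota_uniq //.
under eq_bigr do rewrite cell_measure.
rewrite sumEFin big_const_seq count_predT iter_addr_0 lee_fin size_filter.
rewrite /active; set n := count _ _; rewrite /width -(mulr_natl _ n) => h.
have {}h : (n * 2 ^ e.+3 <= scale s)%N.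
  rewrite -(ler_nat R) natrM natrX.
  by move: h; rewrite exprVn ler_pdivrMr ?ltr0n ?scale_gt0 // mulrC ler_pdivlMr ?exprn_gt0.
have := leq_trans h (half_nodes s); rewrite expnS.
by rewrite mulnCA leq_pmul2l.
Qed.

(** If the e-th test captured the limit point at level [e.+3], one of its
    intervals would contain a whole cell of the branch, and that cell would be
    struck. *)
Lemma branch_point_random b :
  limit_branch hit b -> martin_lof_random (branch_point b R).
Proof.
move=> bP [L [[[c Lc] Lm] LB]].
set e := code_num c.
have := LB e.+3 I; rewrite Lc => -[i [j [/halts_byP[s0 hs0] /andP[h1 h2]]]].
have d1 : 0 < branch_point b R - ratr (rat_of_code i) by lra.
have d2 : 0 < ratr (rat_of_code j) - branch_point b R by lra.
have [s1 s1P] := width_small R _ d1; have [s2 s2P] := width_small R _ d2.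
pose s := (maxn s1 s2 + (i + j + s0 + e).+1)%N.
have w1 : width R s < branch_point b R - ratr (rat_of_code i) by apply: s1P; lia.
have w2 : width R s < ratr (rat_of_code j) - branch_point b R by apply: s2P; lia.
have := branch_point_ge b bP R s; have := branch_point_le b bP R s.
have := widthE b R s => wE h3 h4.
have hs : hit e s (b s).
  apply/hitP; exists i, j; split; [lia|lia| | |].
  - by apply: halts_by_mono hs0; lia.
  - by rewrite -(ltr_rat R); lra.
  - by rewrite -(ltr_rat R); lra.
have [_ _ /negP nb _ _] := bP s; apply: nb; apply/badP; exists e; first lia.
apply/struckP; exists s; rewrite ancn; split=> //.
by apply: active_measure; rewrite -Lc; exact: Lm.
Qed.

End Random.

Theorem theorem25 (R : realType) :
  exists (beta : R) (h ft ht : R -> R),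
    computably_approximable beta /\ martin_lof_random beta /\
    translation_function_interval (fun x => - h x) h beta 0 /\
    translation_function_interval ft ht beta beta /\
    (exists L : R, L.-lipschitz h) /\
    nondecreasing_fun ft /\ nondecreasing_fun ht /\
    liminf_left (fun x => `|diff_quotient h beta x|) beta = 0%:E /\
    liminf_right (fun x => `|diff_quotient h beta x|) beta = 0%:E /\
    limsup_left (fun x => `|diff_quotient h beta x|) beta = 1%:E /\
    limsup_right (fun x => `|diff_quotient h beta x|) beta = 1%:E /\
    limsup_left (fun x => `|diff_quotient ft beta x|) beta = +oo%E /\
    limsup_right (fun x => `|diff_quotient ht beta x|) beta = +oo%E.
Proof.
have [b bP] := limit_branch_exists hit hitS.
have densel (x : R) : exists n, x - 2 <= ratr (point n) < x.
  have [n nE] := point_int (Num.floor x - 1); exists n.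
  rewrite nE ratr_int intrB; have := floor_le x; have := floorD1_gt x.
  by rewrite intrD; lra.
have denser (x : R) : exists n, x < ratr (point n) <= x + 2.
  have [n nE] := point_int (Num.floor x + 1); exists n.
  rewrite nE ratr_int; have := floor_le x; have := floorD1_gt x.
  by rewrite intrD; lra.
have [h [ft [ht hP]]] := envelope_interval R point (branch_point b R) pointc
  computes_pointc (fun=> erefl) densel denser
  (branch_point_left_limit b bP R) (branch_point_right_limit b bP R)
  (branch_point_left_gaps b bP R) (branch_point_right_gaps b bP R).
exists (branch_point b R), h, ft, ht; split; last by split; [exact: branch_point_random|].
exact: branch_point_approximable.
Qed.
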